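(* (i) If $R$ is an under radical then $R^{\ast}$ is the smallest radical larger than or equal to $R$. (ii) If $R$ is an over radical then $R^{\circ}$ is the largest radical smaller than or equal to $R$.
   Context: A Banach Lie algebra is a complex Lie algebra $\mathcal{L}$ which is a Banach space in some norm such that, for some constant $t_{\mathcal{L}}>0$, $\|[a,b]\|\leq t_{\mathcal{L}}\|a\|\|b\|$ for all $a,b\in\mathcal{L}$. $\overline{\mathbf{L}}$ is the category of all Banach Lie algebras whose morphisms are bounded Lie homomorphisms with dense image. A preradical (in $\overline{\mathbf{L}}$) is a map $R$ that sends each Banach Lie algebra $\mathcal{L}$ to a closed Lie ideal $R(\mathcal{L})$ of $\mathcal{L}$ such that $f(R(\mathcal{L}))\subseteq R(\mathcal{M})$ for each morphism $f:\mathcal{L}\to\mathcal{M}$. It is lower stable if $R(R(\mathcal{L}))=R(\mathcal{L})$ for all $\mathcal{L}$; upper stable if $R(\mathcal{L}/R(\mathcal{L}))=\{0\}$ for all $\mathcal{L}$; balanced if $R(I)\subseteq R(\mathcal{L})$ for every closed Lie ideal $I$ of every $\mathcal{L}$. An under radical is a lower stable balanced preradical; an over radical is an upper stable balanced preradical; a radical is a lower stable, upper stable and balanced preradical. $T\leq R$ means $T(\mathcal{L})\subseteq R(\mathcal{L})$ for all $\mathcal{L}$; ''larger'', ''smaller'', ''largest'', ''smallest'' refer to this order. For a preradical $R$: put $R^{0}(\mathcal{L})=\mathcal{L}$, $R^{\alpha+1}(\mathcal{L})=R(R^{\alpha}(\mathcal{L}))$, $R^{\alpha}(\mathcal{L})=\bigcap_{\alpha'<\alpha}R^{\alpha'}(\mathcal{L})$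 for limit ordinals $\alpha$; this decreasing transfinite chain of closed ideals stabilizes and $R^{\circ}(\mathcal{L})$ is its stable value. Put $R^{(0)}(\mathcal{L})=\{0\}$, $R^{(\alpha+1)}(\mathcal{L})=q_{\alpha}^{-1}\big(R(\mathcal{L}/R^{(\alpha)}(\mathcal{L}))\big)$, where $q_{\alpha}:\mathcal{L}\to\mathcal{L}/R^{(\alpha)}(\mathcal{L})$ is the quotient map, and $R^{(\alpha)}(\mathcal{L})=\overline{\bigcup_{\alpha'<\alpha}R^{(\alpha')}(\mathcal{L})}$ for limit ordinals $\alpha$; this increasing transfinite chain of closed ideals stabilizes and $R^{\ast}(\mathcal{L})$ is its stable value. *)

(* Defs.v *)
From HB Require Import structures.
From mathcomp Require Import all_boot all_order all_algebra ring.
From mathcomp Require Import generic_quotient ring_quotient complex.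
From mathcomp Require Import wochoice.
From mathcomp Require Import all_classical reals topology normedtype sequences.

Set Implicit Arguments.
Unset Strict Implicit.
Unset Printing Implicit Defensive.
Set SsrOldRewriteGoalsOrder.

Import Order.TTheory GRing.Theory Num.Theory.
Import numFieldNormedType.Exports.

Local Open Scope complex_scope.
Local Open Scope quotient_scope.
Local Open Scope ring_scope.
Local Open Scope classical_set_scope.

(* The scalars are R[i], so norms take their values in R[i]; in the order of R[i],
   0 < t entails that t is real. *)
HB.mixin Record isBanachLie (R : realType) L & CompleteNormedModule R[i] L := {
  lie : L -> L -> L;
  lie_linearl : forall y, linear (lie^~ y);
  lie_linearr : forall x, linear (lie x);
  liexx : forall x, lie x x = 0;
  lie_jacobi : forall x y z,
    lie x (lie y z) + lie y (lie z x) + lie z (lie x y) = 0;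
  lie_bounded : exists2 t : R[i], 0 < t &
    forall x y, `|lie x y| <= t * `|x| * `|y|
}.

#[short(type="banachLieType")]
HB.structure Definition BanachLie (R : realType) :=
  {L of CompleteNormedModule R[i] L & isBanachLie R L}.

Section Closed.
Variables (R : realType) (L : banachLieType R).
Implicit Types (A : set L) (x y : L).

Definition closed_subspace A :=
  [/\ A 0, forall (a : R[i]) x y, A x -> A y -> A (a *: x + y) & closed A].

Definition closed_lie_subalgebra A :=
  closed_subspace A /\ forall x y, A x -> A y -> A (lie x y).

(* Since lie x y = - lie y x, one side is enough. *)
Definition closed_lie_ideal A :=
  closed_subspace A /\ forall x y, A y -> A (lie x y).

Record closedSubalgebra := ClosedSubalgebra {
  subalgebra_set :> set L;
  subalgebraP : closed_lie_subalgebra subalgebra_set }.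

Record closedIdeal := ClosedIdeal {
  ideal_set :> set L;
  idealP : closed_lie_ideal ideal_set }.

Lemma ideal_subalgebra (I : closedIdeal) : closed_lie_subalgebra (ideal_set I).
Proof. by have [sI lI] := idealP I; split=> // x y _; exact: lI. Qed.

Coercion subalgebra_of_ideal (I : closedIdeal) : closedSubalgebra :=
  ClosedSubalgebra (ideal_subalgebra I).

End Closed.

Section Lemmas.
Variables (R : realType) (L : banachLieType R).
Implicit Types (x y z : L) (a : R[i]).

Lemma lie0r x : lie x 0 = 0.
Proof. by have := lie_linearr x (-1) 0 0; rewrite addr0 scaler0 scaleN1r addNr. Qed.
Lemma lie0l x : lie 0 x = 0.
Proof. by have := lie_linearl x (-1) 0 0; rewrite addr0 scaler0 scaleN1r addNr. Qed.
Lemma lieDr x y z : lie x (y + z) = lie x y + lie x z.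
Proof. by have := lie_linearr x 1 y z; rewrite !scale1r. Qed.
Lemma lieDl x y z : lie (x + y) z = lie x z + lie y z.
Proof. by have := lie_linearl z 1 x y; rewrite !scale1r. Qed.
Lemma lieC x y : lie x y = - lie y x.
Proof.
apply/eqP; rewrite -addr_eq0; have := liexx (x + y).
by rewrite lieDr !lieDl !liexx add0r addr0 addrC => ->.
Qed.
Lemma lieBr x y z : lie x (y - z) = lie x y - lie x z.
Proof.
by have := lie_linearr x (-1) z y; rewrite !scaleN1r ![- _ + _]addrC.
Qed.
Lemma lieBl x y z : lie (x - y) z = lie x z - lie y z.
Proof. by rewrite ![lie _ z]lieC lieBr opprB opprK addrC. Qed.
End Lemmas.

(* A closed Lie subalgebra (in particular a closed Lie ideal) is a Banach Lie
   algebra for the restricted norm and bracket. *)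
Section Sub.
Variables (R : realType) (L : banachLieType R) (A : closedSubalgebra L).

Definition sublie_pred : {pred L} := [pred x | x \in (A : set L)].

Lemma sublie_submod : GRing.submod_closed sublie_pred.
Proof.
have [[A0 AD _] _] := subalgebraP A; split=> [|a x y].
  by rewrite -topredE /=; exact/mem_set.
by rewrite -!topredE /= => /set_mem Ax /set_mem Ay; exact/mem_set/AD.
Qed.

HB.instance Definition _ :=
  GRing.isSubmodClosed.Build R[i] L sublie_pred sublie_submod.

Definition sublie : Type := {x : L | sublie_pred x}.

HB.instance Definition _ := SubType.on sublie.
HB.instance Definition _ := Choice.on sublie.
HB.instance Definition _ := [SubChoice_isSubLmodule of sublie by <:].

Definition sublie_norm (x : sublie) : R[i] := `|val x|.

Lemma sublie_ler_normD x y : sublie_norm (x + y) <= sublie_norm x + sublie_norm y.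
Proof. by rewrite /sublie_norm linearD ler_normD. Qed.

Lemma sublie_normrZ (a : R[i]) x : sublie_norm (a *: x) = `|a| * sublie_norm x.
Proof. by rewrite /sublie_norm linearZ normrZ. Qed.

Lemma sublie_normr0_eq0 x : sublie_norm x = 0 -> x = 0.
Proof. by move=> /normr0_eq0 x0; apply/val_inj; rewrite x0 linear0. Qed.

HB.instance Definition _ := Lmodule_isNormed.Build R[i] sublie
  sublie_ler_normD sublie_normrZ sublie_normr0_eq0.

Lemma sublieP (x : sublie) : (A : set L) (val x).
Proof. by have := valP x; rewrite /sublie_pred /= => /set_mem. Qed.

Lemma sublie_normB (x y : sublie) : `|x - y| = `|val x - val y|.
Proof. by rewrite [LHS]/(sublie_norm _) /sublie_norm linearB. Qed.

Lemma sublie_complete (F : set_system sublie) :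
  ProperFilter F -> cauchy F -> cvg F.
Proof.
move=> FF /(cauchyP F) Fc.
have cG : cauchy (fmap (val : sublie -> L) F).
  apply/cauchy_exP => e /Fc[x Fx]; exists (val x).
  rewrite /fmap/= -ball_normE; apply: filterS Fx => y.
  by rewrite -ball_normE /= sublie_normB.
have /cvg_ex[l Fl] : cvg (fmap (val : sublie -> L) F) by exact: cauchy_cvg.
have Al : (A : set L) l.
  have [[_ _ cA] _] := subalgebraP A.
  have nA : \forall x \near F, (A : set L) (val x) by exact/nearW/sublieP.
  exact: (closed_cvg (subalgebra_set A) cA nA l Fl).
apply/cvg_ex; exists (exist _ l (mem_set Al)).
apply/cvgrPdist_lt => e e0; move/cvgrPdist_lt/(_ e e0) : Fl.
by apply: filterS => y; rewrite sublie_normB.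
Qed.

HB.instance Definition _ := Uniform_isComplete.Build sublie sublie_complete.

Lemma sublie_lie_subproof (x y : sublie) : sublie_pred (lie (val x) (val y)).
Proof.
by have [_ lA] := subalgebraP A; apply/mem_set/lA; exact: sublieP.
Qed.

Definition sublie_lie (x y : sublie) : sublie :=
  exist _ (lie (val x) (val y)) (sublie_lie_subproof x y).

Lemma sublie_linearl y : linear (sublie_lie^~ y).
Proof. by move=> a u v; apply/val_inj; rewrite [RHS]linearP -lie_linearl -linearP. Qed.

Lemma sublie_linearr x : linear (sublie_lie x).
Proof. by move=> a u v; apply/val_inj; rewrite [RHS]linearP -lie_linearr -linearP. Qed.

Lemma sublie_xx x : sublie_lie x x = 0.
Proof. by apply/val_inj; rewrite [RHS]linear0; exact: liexx. Qed.

Lemma sublie_jacobi x y z : sublie_lie x (sublie_lie y z) +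
  sublie_lie y (sublie_lie z x) + sublie_lie z (sublie_lie x y) = 0.
Proof. by apply/val_inj; rewrite !linearD [RHS]linear0; exact: lie_jacobi. Qed.

Lemma sublie_bounded : exists2 t : R[i], 0 < t &
  forall x y, `|sublie_lie x y| <= t * `|x| * `|y|.
Proof. by have [t t0 tP] := @lie_bounded R L; exists t => // x y; exact: tP. Qed.

HB.instance Definition _ := isBanachLie.Build R sublie
  sublie_linearl sublie_linearr sublie_xx sublie_jacobi sublie_bounded.

Definition incl (x : sublie) : L := val x.
End Sub.

Lemma halves (R : realType) : exists d : nat -> R,
  [/\ forall n, 0 < d n, forall n, d n.+1 + d n.+1 = d n,
      forall m n, (m <= n)%N -> d n <= d m & d @ \oo --> (0 : R)].
Proof.
exists (fun n => 2^-1 ^+ n); split=> [n|n|m n mn|].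
- by rewrite exprn_gt0// invr_gt0.
- by rewrite exprSr -splitr.
- by rewrite ler_wiXn2l// ?invr_ge0// invf_le1// ler1n.
- by apply: cvg_expr; rewrite ger0_norm ?invr_ge0// invf_lt1// ltr1n.
Qed.

(* L / I with the norm of u equal to the infimum of `|x| over the x in the
   coset u. *)
Section Quot.
Variables (R : realType) (L : banachLieType R) (I : closedIdeal L).

HB.instance Definition _ := GRing.SubmodClosed.on (sublie_pred I).

Definition quotlie : Type := {ideal_quot sublie_pred I}.

HB.instance Definition _ := Choice.on quotlie.
HB.instance Definition _ := EqQuotient.on quotlie.
HB.instance Definition _ := GRing.Zmodule.on quotlie.
HB.instance Definition _ := ZmodQuotient.on quotlie.

Definition quotmap (x : L) : quotlie := \pi_quotlie x.

Lemma quotmapD x y : quotmap (x + y) = quotmap x + quotmap y.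
Proof. by rewrite /quotmap piE. Qed.

Lemma quotmapN x : quotmap (- x) = - quotmap x.
Proof. by rewrite /quotmap piE. Qed.

Lemma quotmapB x y : quotmap (x - y) = quotmap x - quotmap y.
Proof. by rewrite quotmapD quotmapN. Qed.

Lemma quotmap0 : quotmap 0 = 0.
Proof. by rewrite -(subrr 0) quotmapB subrr. Qed.

Lemma quotmap_eq x y : quotmap x = quotmap y <-> ideal_set I (x - y).
Proof.
split=> [/eqP|Ixy].
  by rewrite /quotmap -Quotient.idealrBE -topredE /= => /set_mem.
by apply/eqP; rewrite /quotmap -Quotient.idealrBE -topredE; exact: mem_set.
Qed.

Lemma quotmap_eq0 x : quotmap x = 0 <-> ideal_set I x.
Proof. by rewrite -quotmap0 quotmap_eq subr0. Qed.

Lemma quotmap_repr u : quotmap (repr u) = u.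
Proof. by rewrite /quotmap reprK. Qed.

Lemma ideal0 : ideal_set I 0. Proof. by have [[]] := idealP I. Qed.

Lemma idealD a x y : ideal_set I x -> ideal_set I y -> ideal_set I (a *: x + y).
Proof. by have [[? H ?] ?] := idealP I; exact: H. Qed.

Definition quotlie_scale (a : R[i]) (u : quotlie) := quotmap (a *: repr u).

Lemma quotmapZ a x : quotmap (a *: x) = quotlie_scale a (quotmap x).
Proof.
apply/quotmap_eq; rewrite -scalerBr -[_ *: _]addr0.
by apply: idealD ideal0; apply/quotmap_eq; rewrite quotmap_repr.
Qed.

Lemma quotlie_scaleA a b u :
  quotlie_scale a (quotlie_scale b u) = quotlie_scale (a * b) u.
Proof. by rewrite -(quotmap_repr u) -!quotmapZ scalerA. Qed.

Lemma quotlie_scale1 : left_id 1 quotlie_scale.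
Proof. by move=> u; rewrite -(quotmap_repr u) -quotmapZ scale1r. Qed.

Lemma quotlie_scaleDr : right_distributive quotlie_scale +%R.
Proof.
move=> a u v; rewrite -(quotmap_repr u) -(quotmap_repr v).
by rewrite -quotmapD -!quotmapZ -quotmapD scalerDr.
Qed.

Lemma quotlie_scaleDl u : {morph quotlie_scale^~ u : a b / a + b}.
Proof.
by move=> a b; rewrite -(quotmap_repr u) -!quotmapZ -quotmapD scalerDl.
Qed.

HB.instance Definition _ := GRing.Zmodule_isLmodule.Build R[i] quotlie
  quotlie_scaleA quotlie_scale1 quotlie_scaleDr quotlie_scaleDl.

Lemma quotmap_linear : linear quotmap.
Proof. by move=> a x y; rewrite quotmapD quotmapZ. Qed.

HB.instance Definition _ :=
  GRing.isLinear.Build R[i] L quotlie _ quotmap quotmap_linear.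

Let nrm (x : L) : R := complex.Re `|x|.

Let nrmE x : `|x| = (nrm x)%:C.
Proof. by rewrite /nrm RRe_real// realE normr_ge0. Qed.

Let nrm_ge0 x : 0 <= nrm x.
Proof. by rewrite -ler0c -nrmE. Qed.

Let nrmD x y : nrm (x + y) <= nrm x + nrm y.
Proof. by rewrite -lecR rmorphD /= -!nrmE ler_normD. Qed.

Let coset_norms (u : quotlie) : set R :=
  [set complex.Re `|x| | x in [set x : L | quotmap x = u]].

Let coset_norms_inf u : has_inf (coset_norms u).
Proof.
split; first by exists (nrm (repr u)), (repr u) => //=; exact: quotmap_repr.
by exists 0 => _ [x _ <-]; exact: nrm_ge0.
Qed.

Definition quotlie_norm (u : quotlie) : R[i] := (inf (coset_norms u))%:C.

Let qnrm u := inf (coset_norms u).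

Let qnrm_le x : qnrm (quotmap x) <= nrm x.
Proof. by apply: ge_inf; [exact: (coset_norms_inf _).2 | exists x]. Qed.

Let qnrm_ge u c : (forall x, quotmap x = u -> c <= nrm x) -> c <= qnrm u.
Proof.
move=> h; apply: lb_le_inf; first exact: (coset_norms_inf _).1.
by move=> _ [x xu <-]; exact: h.
Qed.

Let qnrm_lt u e : 0 < e -> exists2 x, quotmap x = u & nrm x < qnrm u + e.
Proof.
move=> e0; have [_ [x xu <-] xe] := inf_adherent e0 (coset_norms_inf u).
by exists x.
Qed.

Let qnrm_ge0 u : 0 <= qnrm u.
Proof. exact: qnrm_ge. Qed.

Let qnrm_scale u a c : 0 <= a ->
  (forall x, quotmap x = u -> c <= a * nrm x) -> c <= a * qnrm u.
Proof.
rewrite le_eqVlt => /predU1P[<-|a0] h.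
  by rewrite mul0r -(mul0r (nrm (repr u))); apply/h/quotmap_repr.
by rewrite -ler_pdivrMl//; apply: qnrm_ge => x xu; rewrite ler_pdivrMl//; exact: h.
Qed.

Lemma quotlie_ler_normD u v :
  quotlie_norm (u + v) <= quotlie_norm u + quotlie_norm v.
Proof.
rewrite /quotlie_norm -rmorphD /= lecR -/(qnrm _) -/(qnrm u) -/(qnrm v).
rewrite -lerBlDr; apply: qnrm_ge => x xu; rewrite lerBlDr -lerBlDl.
apply: qnrm_ge => y yv; rewrite lerBlDl -xu -yv -quotmapD.
exact: le_trans (qnrm_le _) (nrmD _ _).
Qed.

Let quotlie_normZ_le (a : R[i]) u :
  quotlie_norm (a *: u) <= `|a| * quotlie_norm u.
Proof.
have aE : `|a| = (complex.Re `|a|)%:C by rewrite RRe_real// realE normr_ge0.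
rewrite /quotlie_norm aE -rmorphM /= lecR -/(qnrm _) -/(qnrm u).
apply: qnrm_scale => [|x xu]; first by rewrite -ler0c -aE.
rewrite -xu -linearZ /=; apply: le_trans (qnrm_le _) _.
by rewrite -lecR rmorphM /= -nrmE -aE -nrmE normrZ.
Qed.

Lemma quotlie_normrZ (a : R[i]) u :
  quotlie_norm (a *: u) = `|a| * quotlie_norm u.
Proof.
apply/eqP; rewrite eq_le quotlie_normZ_le /=.
have [->|a0] := eqVneq a 0.
  by rewrite normr0 mul0r; rewrite /quotlie_norm ler0c; exact: qnrm_ge0.
rewrite -ler_pdivlMl ?normr_gt0// -normfV.
by apply: le_trans (quotlie_normZ_le _ _); rewrite scalerA mulVf// scale1r.
Qed.

Lemma quotlie_normr0_eq0 u : quotlie_norm u = 0 -> u = 0.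
Proof.
move=> /(congr1 (@complex.Re R)) /= u0; rewrite -(quotmap_repr u).
apply/quotmap_eq0; have [[_ _ cI] _] := idealP I; apply: cI.
move=> B /nbhs_ballP[e e0]; rewrite -ball_normE => eB.
have e0' : 0 < complex.Re e by move: e0; rewrite /= ltcE => /andP[].
have eE : e = (complex.Re e)%:C by rewrite RRe_real// realE ltW.
have [x xu xe] := qnrm_lt u e0'; rewrite [qnrm u]u0 add0r in xe.
exists (repr u - x); split; first by apply/quotmap_eq; rewrite quotmap_repr.
by apply: eB; rewrite /= opprB addrC subrK nrmE eE ltcR.
Qed.

HB.instance Definition _ := Lmodule_isNormed.Build R[i] quotlie
  quotlie_ler_normD quotlie_normrZ quotlie_normr0_eq0.

Lemma quotmap_norm_le x : `|quotmap x| <= `|x|.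
Proof. by rewrite [leLHS]/(quotlie_norm _) nrmE lecR; exact: qnrm_le. Qed.

Let lift_lt u (e : R) : 0 < e -> `|u| < e%:C ->
  exists2 x, quotmap x = u & `|x| < e%:C.
Proof.
move=> e0; rewrite [ltLHS]/(quotlie_norm _) ltcR -/(qnrm u) => ue.
have eu0 : 0 < e - qnrm u by rewrite subr_gt0.
have [x xu xe] := qnrm_lt u eu0.
by exists x => //; rewrite nrmE ltcR; rewrite addrC subrK in xe.
Qed.

Lemma quotlie_complete (F : set_system quotlie) :
  ProperFilter F -> cauchy F -> cvg F.
Proof.
move=> FF /(cauchyP F) Fc.
have [d [d0 dS dle dcvg]] := halves R.
have /choice[q Fq] : forall n, exists u, F (ball u (d n)%:C).
  by move=> n; apply: Fc; rewrite ltcR.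
have qS n : `|q n.+1 - q n| < (d n + d n.+1)%:C.
  have [u [] ] := filter_ex (filterI (Fq n.+1) (Fq n)).
  rewrite -!ball_normE /= => u1 u2.
  rewrite (_ : q n.+1 - q n = (q n.+1 - u) - (q n - u)); last first.
    by rewrite opprB addrA subrK.
  by rewrite (le_lt_trans (ler_normB _ _))// addrC rmorphD /= ltrD.
have step n (x : {x : L | quotmap x = q n}) : {y : {y : L | quotmap y = q n.+1} |
    `|sval y - sval x| < (d n + d n.+1)%:C}.
  case: x => x xq; apply: cid.
  have [z zq ze] := lift_lt (addr_gt0 (d0 n) (d0 n.+1)) (qS n).
  have yq : quotmap (x + z) = q n.+1 by rewrite quotmapD zq xq addrC subrK.
  by exists (exist _ (x + z) yq) => /=; rewrite addrAC subrr add0r.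
pose X := fix X n : {x : L | quotmap x = q n} := if n is m.+1
  then sval (step m (X m)) else exist _ (repr (q 0%N)) (quotmap_repr (q 0%N)).
pose x n := sval (X n).
have xq n : quotmap (x n) = q n by rewrite /x; case: (X n).
have xS n : `|x n.+1 - x n| < (d n + d n.+1)%:C.
  by rewrite {1}/x /=; case: (step n (X n)).
have xB n k : `|x (n + k)%N - x n| <= (d n *+ 3 - d (n + k)%N *+ 3)%:C.
  elim: k => [|k IH]; first by rewrite addn0 !subrr normr0.
  rewrite addnS -(subrK (x (n + k)%N) (x (n + k).+1)) -addrA.
  rewrite (le_trans (ler_normD _ _))//.
  rewrite (le_trans (lerD (ltW (xS _)) IH))// -rmorphD /= lecR.
  rewrite -(dS (n + k)%N) le_eqVlt; apply/orP; left; apply/eqP.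
  by ring.
have xB' n k : (n <= k)%N -> `|x n - x k| < (d n *+ 3)%:C.
  move=> nk; rewrite distrC -(subnKC nk) (le_lt_trans (xB _ _))// ltcR.
  by rewrite ltrBlDr ltrDl pmulrn_lgt0.
have dsmall (e : R[i]) : 0 < e -> exists n, (d n *+ 3)%:C < e.
  rewrite ltcE /= => /andP[/eqP ei e0].
  have : (fun n => d n *+ 3) @ \oo --> (0 : R).
    by rewrite -(mul0rn _ 3); exact: cvgMn.
  move=> /cvgrPdist_lt/(_ _ e0)[n _ /(_ n (leqnn n))] /=.
  rewrite sub0r normrN ger0_norm ?mulrn_wge0 ?ltW// => dn.
  by exists n; rewrite ltcE /= -ei eqxx.
have cx : cauchy (x @ \oo).
  apply/cauchy_exP => e /dsmall[n ne]; exists (x n).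
  rewrite -ball_normE; exists n => // k /= nk.
  exact: lt_trans (xB' _ _ nk) ne.
have /cvg_ex[l xl] : cvg (x @ \oo) by exact: cauchy_cvg.
apply/cvg_ex; exists (quotmap l).
apply/cvgrPdist_lt => e e0.
have e20 : 0 < e / 2 by rewrite divr_gt0.
have [n ne] := dsmall _ e20.
move/cvgrPdist_lt : xl => /(_ _ e20)[m _ mx].
pose k := maxn n m.
have := Fq k; apply: filterS => u; rewrite -ball_normE /= => uk.
rewrite (_ : quotmap l - u = quotmap (l - x k) + (q k - u)); last first.
  by rewrite quotmapB xq addrA subrK.
rewrite (le_lt_trans (ler_normD _ _))// [ltRHS]splitr ltrD//.
  rewrite (le_lt_trans (quotmap_norm_le _))//; apply: mx.
  by rewrite /= leq_maxr.
rewrite (lt_trans uk)// (le_lt_trans _ ne)// lecR.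
rewrite (@le_trans _ _ (d n))//.
  by rewrite dle// leq_maxl.
by rewrite mulrS lerDl mulrn_wge0// ltW.
Qed.

HB.instance Definition _ := Uniform_isComplete.Build quotlie quotlie_complete.

Definition quotlie_lie (u v : quotlie) := quotmap (lie (repr u) (repr v)).

Lemma quotmap_lie x y : quotmap (lie x y) = quotlie_lie (quotmap x) (quotmap y).
Proof.
apply/quotmap_eq; set x' := repr _; set y' := repr _.
rewrite (_ : _ - _ = lie x (y - y') + lie (x - x') y'); last first.
  by rewrite lieBr lieBl addrA subrK.
have [_ lI] := idealP I; rewrite -[lie x _]scale1r; apply: idealD.
  by apply: lI; apply/quotmap_eq; rewrite quotmap_repr.
rewrite lieC -[- _]addr0 -scaleN1r; apply: idealD ideal0; apply: lI.
by apply/quotmap_eq; rewrite quotmap_repr.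
Qed.

Lemma quotlie_linearl v : linear (quotlie_lie^~ v).
Proof.
move=> a u w; rewrite -(quotmap_repr u) -(quotmap_repr v) -(quotmap_repr w).
by rewrite -linearP -!quotmap_lie lie_linearl linearP.
Qed.

Lemma quotlie_linearr u : linear (quotlie_lie u).
Proof.
move=> a v w; rewrite -(quotmap_repr u) -(quotmap_repr v) -(quotmap_repr w).
by rewrite -linearP -!quotmap_lie lie_linearr linearP.
Qed.

Lemma quotlie_xx u : quotlie_lie u u = 0.
Proof. by rewrite -(quotmap_repr u) -quotmap_lie liexx quotmap0. Qed.

Lemma quotlie_jacobi u v w : quotlie_lie u (quotlie_lie v w) +
  quotlie_lie v (quotlie_lie w u) + quotlie_lie w (quotlie_lie u v) = 0.
Proof.
rewrite -(quotmap_repr u) -(quotmap_repr v) -(quotmap_repr w).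
by rewrite -!quotmap_lie -!quotmapD lie_jacobi quotmap0.
Qed.

Lemma quotlie_bounded : exists2 t : R[i], 0 < t &
  forall u v, `|quotlie_lie u v| <= t * `|u| * `|v|.
Proof.
have [t t0 tP] := @lie_bounded R L; exists t => // u v.
have tE : t = (complex.Re t)%:C by rewrite RRe_real// realE ltW.
have t0' : 0 < complex.Re t by rewrite -ltcR -tE.
rewrite [`|_|]/(quotlie_norm _) [`|u|]/(quotlie_norm _) [`|v|]/(quotlie_norm _).
rewrite /quotlie_norm -/(qnrm _) -/(qnrm u) -/(qnrm v) tE -!rmorphM /= lecR.
apply: qnrm_scale => [|y yv]; first by rewrite mulr_ge0// ltW.
rewrite mulrAC; apply: qnrm_scale => [|x xu]; first by rewrite mulr_ge0// ltW.
rewrite -xu -yv -quotmap_lie (le_trans (qnrm_le _))// -lecR !rmorphM /=.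
by rewrite -!nrmE -tE mulrAC.
Qed.

HB.instance Definition _ := isBanachLie.Build R quotlie
  quotlie_linearl quotlie_linearr quotlie_xx quotlie_jacobi quotlie_bounded.

End Quot.

(* well_order (every nonempty subset has a unique minimum for the reflexive
   relation) is the notion of mathcomp.classical.wochoice. *)
Record woset := Woset {
  wo_sort :> eqType;
  wo_le : rel wo_sort;
  wo_leP : well_order wo_le }.

Section Woset.
Variable W : woset.
Implicit Types a b c : W.

Definition wo_lt : rel W := [rel a b | (a != b) && wo_le a b].

Definition wo_succ b a := wo_lt b a /\ forall c, wo_lt c a -> wo_le c b.

Lemma wo_le_anti : antisymmetric (@wo_le W).
Proof.
by apply: in2T; apply: wo_chain_antisymmetric; apply: withinW; exact: wo_leP.
Qed.

Lemma wo_le_total : total (@wo_le W).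
Proof.
by apply: in2T; apply: wo_chainW; apply: withinW; exact: wo_leP.
Qed.

Lemma wo_ltNle a b : wo_lt a b -> ~~ wo_le b a.
Proof.
move=> /andP[ab lab]; apply: contra ab => lba; apply/eqP/wo_le_anti.
by rewrite lab lba.
Qed.

Lemma wo_lt_wf : well_founded (fun a b => wo_lt a b).
Proof.
move=> a; apply: contrapT => na.
pose A : {pred W} := [pred b | ~~ `[< Acc (fun x y => wo_lt x y) b >]].
have [|b [[Ab lb] _]] := @wo_leP W A.
  by exists a; rewrite !inE; exact/asboolPn.
move: (Ab); rewrite inE => /asboolPn; apply.
constructor=> c cb; apply: contrapT => nc.
have := wo_ltNle cb; rewrite (lb c)// inE; exact/asboolPn.
Qed.

Lemma wo_succ_inj b b' a : wo_succ b a -> wo_succ b' a -> b = b'.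
Proof.
by move=> [ba bP] [b'a b'P]; apply: wo_le_anti; rewrite bP ?b'P.
Qed.

End Woset.

(* Recursion along a well-ordered set: value z at the least element, s at
   successors, and l applied to the set of all earlier values at limits; see
   transfinite0, transfiniteS and transfinite_lim. *)
Section Transfinite.
Variables (T : Type) (z : T) (s : T -> T) (l : set T -> T) (W : woset).

Definition transfinite_step (a : W) (f : forall b, wo_lt b a -> T) : T :=
  if pselect (exists b, wo_lt b a) then
    match pselect (exists b, wo_succ b a) with
    | left ab => let: exist b ba := cid ab in s (f b ba.1)
    | right _ => l [set t | exists b (ba : wo_lt b a), f b ba = t]
    end
  else z.

Definition transfinite : W -> T :=
  Fix (@wo_lt_wf W) (fun=> T) (@transfinite_step).

Lemma transfiniteE a : transfinite a = @transfinite_step a (fun b _ => transfinite b).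
Proof.
apply: (Fix_eq (@wo_lt_wf W) (fun=> T)) => {}a f g fg; congr transfinite_step.
by apply: functional_extensionality_dep => b; apply/funext => ba; exact: fg.
Qed.

Lemma transfinite0 a : (forall b, ~~ wo_lt b a) -> transfinite a = z.
Proof.
move=> a0; rewrite transfiniteE /transfinite_step.
by case: pselect => // ab; exfalso; have [b] := ab; exact/negP/a0.
Qed.

Lemma transfiniteS a b : wo_succ b a -> transfinite a = s (transfinite b).
Proof.
move=> ba; rewrite transfiniteE /transfinite_step.
case: pselect => [a0|na]; last by case: na; exists b; have [] := ba.
case: pselect => [ab|nab]; last by case: nab; exists b.
by case: (cid ab) => c ca; rewrite (wo_succ_inj ba ca).
Qed.

Lemma transfinite_lim a : (exists b, wo_lt b a) ->
  (forall b, ~ wo_succ b a) ->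
  transfinite a = l (transfinite @` [set b | wo_lt b a]).
Proof.
move=> a0 aS; rewrite transfiniteE /transfinite_step.
case: pselect => // a1; case: pselect => [ab|nab].
  by exfalso; have [b /aS] := ab.
congr l; apply/seteqP; split=> t [b].
  by move=> [ba <-]; exists b.
by move=> ba <-; exists b, ba.
Qed.

End Transfinite.

(* A point of a well-ordered set stands for the ordinal which is the order type
   of the set of its strict predecessors; the ordinal a is at most the ordinal b
   iff the former set embeds into the latter by a strictly increasing map. *)
Record ordinal_number := OrdinalNumber {
  ord_woset : woset;
  ord_point : ord_woset }.

Definition ord_le (a b : ordinal_number) : Prop :=
  exists f : ord_woset a -> ord_woset b,
    (forall x, wo_lt x (ord_point a) -> wo_lt (f x) (ord_point b)) /\
    (forall x y, wo_lt y (ord_point a) -> wo_lt x y -> wo_lt (f x) (f y)).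

(* The value from which the family C, indexed by the ordinals, is constant
   (empty if C never becomes constant). *)
Definition stable_value (T : Type) (C : ordinal_number -> set T) : set T :=
  [set x | exists2 a, forall b, ord_le a b -> C b = C a & C a x].

Definition lie_morphism (R : realType) (L M : banachLieType R)
    (f : {linear L -> M}) : Prop :=
  [/\ forall x y, f (lie x y) = lie (f x) (f y),
      exists2 c : R[i], 0 < c & forall x, `|f x| <= c * `|x| &
      dense (range f)].

Record preradical (R : realType) := Preradical {
  rad :> forall L : banachLieType R, closedIdeal L;
  rad_morphism : forall (L M : banachLieType R) (f : {linear L -> M}),
    lie_morphism f -> f @` rad L `<=` rad M }.

Section Radicals.
Variable R : realType.
Implicit Types P Q : preradical R.

Definition lower_stable P := forall L : banachLieType R,
  @incl R L (P L) @` P (sublie (P L)) = P L :> set L.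

Definition upper_stable P := forall L : banachLieType R,
  P (quotlie (P L)) = [set 0] :> set _.

Definition balanced P := forall (L : banachLieType R) (I : closedIdeal L),
  @incl R L I @` P (sublie I) `<=` P L.

Definition under_radical P := lower_stable P /\ balanced P.

Definition over_radical P := upper_stable P /\ balanced P.

Definition radical P := [/\ lower_stable P, upper_stable P & balanced P].

Definition rad_le P Q := forall L : banachLieType R, P L `<=` Q L.

End Radicals.

Section Chains.
Variables (R : realType) (P : preradical R) (L : banachLieType R).
Implicit Types (A : closedSubalgebra L) (I : closedIdeal L).

Lemma full_subalgebra : closed_lie_subalgebra [set: L].
Proof. by split=> //; split=> //; exact: closedT. Qed.

Lemma rad_subalgebra A :
  closed_lie_subalgebra (@incl R L A @` P (sublie A)).
Proof.
have [[I0 ID cI] lI] := idealP (P (sublie A)); split; first split.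
- by exists 0 => //; rewrite /incl linear0.
- move=> a _ _ [x Ix <-] [y Iy <-]; exists (a *: x + y); first exact: ID.
  by rewrite /incl linearP.
- move=> x clx.
  have Ax : (A : set L) x.
    have [[_ _ cA] _] := subalgebraP A; apply: cA => B /clx[_ [[y _ <-] By]].
    by exists (incl y); split=> //; exact: sublieP.
  exists (exist _ x (mem_set Ax)) => //; apply: cI => B /nbhs_ballP[e e0 eB].
  have [_ [[y Iy <-] xy]] := clx _ (nbhsx_ballx x e e0).
  exists y; split=> //; apply: eB; move: xy.
  by rewrite -!ball_normE /= sublie_normB.
- move=> _ _ [x Ix <-] [y Iy <-]; exists (lie x y) => //; exact: lI.
Qed.

Lemma bigcap_subalgebra (S : set (closedSubalgebra L)) :
  closed_lie_subalgebra (\bigcap_(A in S) subalgebra_set A).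
Proof.
split; first split.
- by move=> A _; have [[]] := subalgebraP A.
- move=> a x y Sx Sy A SA; have [[_ h _] _] := subalgebraP A.
  by apply: h; [exact: Sx|exact: Sy].
- by apply: closed_bigI => A _; have [[]] := subalgebraP A.
- move=> x y Sx Sy A SA; have [_ h] := subalgebraP A.
  by apply: h; [exact: Sx|exact: Sy].
Qed.

(* The terms are carried as closed Lie subalgebras: the image in L of
   P (sublie A) is a closed Lie ideal of A, hence evidently a closed Lie
   subalgebra of L. That it is again an ideal of L when A is one is true, but
   depends on the action of bounded derivations, and is not needed in order to
   apply P to the next term. *)
Definition rad_circ_chain : forall W : woset, W -> closedSubalgebra L :=
  transfinite (ClosedSubalgebra full_subalgebra)
    (fun A => ClosedSubalgebra (rad_subalgebra A))
    (fun S => ClosedSubalgebra (bigcap_subalgebra S)).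

Definition rad_circ : set L :=
  stable_value (fun a => rad_circ_chain (ord_point a) : set L).

Lemma zero_ideal : closed_lie_ideal [set 0 : L].
Proof.
split; first split=> //.
- by move=> a x y -> ->; rewrite scaler0 addr0.
- exact/accessible_closed_set1/hausdorff_accessible/norm_hausdorff.
- by move=> x y ->; rewrite /= lie0r.
Qed.

Lemma quotmap_continuous I : continuous (quotmap I).
Proof.
move=> x; apply/cvgrPdist_lt => e e0; near=> y.
rewrite -linearB; apply: le_lt_trans (quotmap_norm_le _ _) _.
by near: y; exact: cvgr_dist_lt.
Unshelve. all: by end_near. Qed.

Lemma rad_quot_ideal I :
  closed_lie_ideal (quotmap I @^-1` P (quotlie I)).
Proof.
have [[J0 JD cJ] lJ] := idealP (P (quotlie I)); split; first split.
- by rewrite /= linear0.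
- by move=> a x y Jx Jy; rewrite /= linearP; exact: JD.
- by apply: closed_comp cJ => x _; exact: quotmap_continuous.
- by move=> x y Jy; rewrite /= quotmap_lie; exact: lJ.
Qed.

(* Only applied to closures of unions of increasing chains of closed ideals, where
   the default is never reached: see rad_star_chain_lim below. *)
Definition as_ideal (A : set L) : closedIdeal L :=
  match pselect (closed_lie_ideal A) with
  | left AP => ClosedIdeal AP
  | right _ => ClosedIdeal zero_ideal
  end.

Definition rad_star_chain : forall W : woset, W -> closedIdeal L :=
  transfinite (ClosedIdeal zero_ideal)
    (fun I => ClosedIdeal (rad_quot_ideal I))
    (fun S => as_ideal (closure (\bigcup_(I in S) ideal_set I))).

Definition rad_star : set L :=
  stable_value (fun a => rad_star_chain (ord_point a) : set L).

End Chains.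

Arguments rad_circ {R} P L.
Arguments rad_star {R} P L.

Section StarChain.
Variables (R : realType) (P : preradical R) (L : banachLieType R).

Lemma closure_bigcup_ideal (S : set (closedIdeal L)) : S !=set0 ->
  (forall I J, S I -> S J -> I `<=` J \/ J `<=` I) ->
  closed_lie_ideal (closure (\bigcup_(I in S) ideal_set I)).
Proof.
move=> [I0 SI0] Stot; set U := \bigcup_(I in S) _.
have U_ex x y : U x -> U y -> exists2 I, S I & ideal_set I x /\ ideal_set I y.
  move=> [I SI Ix] [J SJ Jy]; have [IJ|JI] := Stot _ _ SI SJ.
    by exists J => //; split=> //; exact: IJ.
  by exists I => //; split=> //; exact: JI.
split; first split.
- by apply: subset_closure; exists I0 => //; exact: ideal0.
- move=> a x y clx cly B /nbhs_ballP[e e0 eB].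
  have k0 : 0 < `|a| + 1 + 1 by rewrite ltr_wpDl// addr_ge0.
  have d0 : 0 < e / (`|a| + 1 + 1) by rewrite divr_gt0.
  have [x' [Ux']] := clx _ (nbhsx_ballx x _ d0).
  have [y' [Uy']] := cly _ (nbhsx_ballx y _ d0).
  rewrite -!ball_normE /= => yd xd.
  exists (a *: x' + y'); split.
    have [I SI [Ix Iy]] := U_ex _ _ Ux' Uy'.
    by exists I => //; exact: idealD.
  apply: eB; rewrite -ball_normE /= opprD addrACA -scalerBr.
  rewrite (le_lt_trans (ler_normD _ _))// normrZ.
  have -> : e = (`|a| + 1) * (e / (`|a| + 1 + 1)) + e / (`|a| + 1 + 1).
    by rewrite -[X in _ + X]mul1r -mulrDl mulrC divfK// gt_eqF.
  by rewrite ler_ltD// ler_pM//; [rewrite lerDl|exact: ltW].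
- exact: closed_closure.
- move=> x y cly B /nbhs_ballP[e e0 eB].
  have [t t0 tP] := @lie_bounded R L.
  have k0 : 0 < t * `|x| + 1 by rewrite ltr_wpDl// mulr_ge0// ltW.
  have d0 : 0 < e / (t * `|x| + 1) by rewrite divr_gt0.
  have [y' [[I SI Iy']]] := cly _ (nbhsx_ballx y _ d0).
  rewrite -!ball_normE /= => yd.
  exists (lie x y'); split.
    by exists I => //; have [_ h] := idealP I; exact: h.
  apply: eB; rewrite -ball_normE /= -lieBr (le_lt_trans (tP _ _))//.
  rewrite ltr_pdivlMr// in yd; apply: le_lt_trans yd.
  by rewrite mulrC ler_wpM2l// lerDl.
Qed.

Lemma rad_star_chain_mono (W : woset) (a b : W) :
  wo_lt b a -> rad_star_chain P L b `<=` rad_star_chain P L a.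
Proof.
elim: {a}(wo_lt_wf a) b => a _ IH b ba.
have [[c ca]|nS] := pselect (exists c, wo_succ c a).
  rewrite {2}/rad_star_chain (transfiniteS _ _ _ ca) -/(rad_star_chain P L).
  have cS : rad_star_chain P L c `<=` quotmap (rad_star_chain P L c) @^-1`
      P (quotlie (rad_star_chain P L c)).
    move=> x /quotmap_eq0 x0; rewrite /preimage /= x0.
    exact: (ideal0 (P (quotlie _))).
  have [->|bc] := eqVneq b c; first exact: cS.
  by move=> x bx; apply: cS; apply: (IH _ ca.1 b) => //; rewrite /wo_lt /= bc ca.2.
rewrite {2}/rad_star_chain transfinite_lim//; last 2 first.
- by exists b.
- by move=> c ca; apply: nS; exists c.
rewrite -/(rad_star_chain P L) /as_ideal; case: pselect => [Ic|[]].
  by move=> x bx; apply: subset_closure; exists (rad_star_chain P L b) => //; exists b.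
apply: closure_bigcup_ideal; first by exists (rad_star_chain P L b), b.
move=> _ _ [c /= ca <-] [d /= da <-].
have [->|cd] := eqVneq c d; first by left.
by case/orP : (wo_le_total c d) => h; [left|right]; apply: IH => //;
  rewrite /wo_lt /= h ?cd// eq_sym cd.
Qed.

Lemma rad_star_chain_lim (W : woset) (a : W) :
  (exists b, wo_lt b a) -> (forall b, ~ wo_succ b a) ->
  rad_star_chain P L a =
  closure (\bigcup_(b in [set b | wo_lt b a]) rad_star_chain P L b) :> set L.
Proof.
move=> a0 aS; rewrite {1}/rad_star_chain transfinite_lim// -/(rad_star_chain P L).
rewrite /as_ideal; case: pselect => [Ic|[]].
  by rewrite /= bigcup_image.
apply: closure_bigcup_ideal.
  by have [b ba] := a0; exists (rad_star_chain P L b), b.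
move=> _ _ [c /= ca <-] [d /= da <-].
have [->|cd] := eqVneq c d; first by left.
by case/orP : (wo_le_total c d) => h; [left|right]; apply: rad_star_chain_mono;
  rewrite /wo_lt /= h ?cd// eq_sym cd.
Qed.

End StarChain.

(* Main.v *)
Require Import Defs.
From HB Require Import structures.
From mathcomp Require Import all_boot all_order all_algebra complex ring.
From mathcomp Require Import wochoice.
From mathcomp Require Import all_classical reals topology normedtype.

(** Both transfinite constructions have a description without ordinals, from which
the theorem follows by chasing morphisms.

The chain defining [rad_star P L] increases. A surjection L/I -> L/J for I inside J
carries [P (L/I)] into [P (L/J)], so every closed ideal J with P(L/J) = 0 contains
the whole chain, while the value at which the chain stops satisfies this equation.
Hence R*(L) is the least closed ideal J with P(L/J) = 0 ([rad_star_spec]), and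
therefore lies in the kernel of every morphism from L to an algebra on which P
vanishes ([star_ideal_ker]); this single fact gives functoriality, upper stability,
balancedness and minimality.

Dually, for a balanced P, R°(L) is the largest closed ideal J of L with P(J) = J
([rad_circ_spec]). Functoriality follows on taking the closure of the image of such
an ideal; for upper stability one shows, with J = R°(L), that the preimage N of
R°(L/J) satisfies P(N) = N, because N/P(N) is a quotient of N/J = R°(L/J), on which
P is everything, whereas P vanishes on N/P(N).

That the chains stop is Cantor's theorem: along a well-order of the set of all sets
of subsets of L, a chain that never stops would be an injection into the subsets
of L. That the stable value does not depend on the ordinal at which it is read off
uses that two points of two well-ordered sets are both bounded in their
well-ordered sum ([stable_value_transfinite]).

The one analytic ingredient is that P(I) is an ideal of L when I is a closed ideal
of L ([rad_in_ideal]); it is needed for the chain of R° to consist of ideals, for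
the balancedness of R° and for the lower stability of R*. An element x of L acts
on I by a bounded derivation D. For small s > 0 the series exp(sD) converges to a
bounded Lie endomorphism of I with dense range, hence preserves P(I), and
(exp(sD)a - a)/s tends to Da as s tends to 0 ([rad_derivation]). *)

Set Implicit Arguments.
Unset Strict Implicit.
Unset Printing Implicit Defensive.

Import Order.TTheory GRing.Theory Num.Theory.
Import numFieldNormedType.Exports.

Local Open Scope ring_scope.
Local Open Scope classical_set_scope.

(** * Estimates in complex normed modules *)

Section Approx.
Variable R : realType.

(** Nonnegative elements of the partially ordered field [R[i]] are real, so that this
is the archimedean property of [R]. *)
Lemma half_pow_small (c e : R[i]) : 0 <= c -> 0 < e ->
  exists n, c * 2^-1 ^+ n < e.
Proof.
move=> c0 e0.
have E (x : R[i]) : 0 <= x -> x = (complex.Re x)%:C%C.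
  by move=> x0; rewrite RRe_real// realE x0.
have {}E : e = (complex.Re e)%:C%C /\ c = (complex.Re c)%:C%C.
  by split; apply: E => //; exact: ltW.
case: E c0 e0 => -> ->; rewrite ler0c ltcR.
move: (complex.Re c) (complex.Re e) => {}c {}e c0 e0.
exists (Num.bound (c / e)).
have -> : (2^-1 : R[i]) = (2^-1 : R)%:C%C by rewrite fmorphV rmorph_nat.
rewrite -rmorphXn -rmorphM /= ltcR exprVn ltr_pdivrMr ?exprn_gt0//.
rewrite mulrC -ltr_pdivrMr//.
apply: (lt_le_trans (archi_boundP _)); first by rewrite divr_ge0// ltW.
by rewrite -natrX ler_nat ltnW// ltn_expl.
Qed.

Lemma le_half_pow_eq0 (V : normedModType R[i]) (x : V) (c : R[i]) :
  (forall n, `|x| <= c * 2^-1 ^+ n) -> x = 0.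
Proof.
move=> h; apply/normr0_eq0/eqP; rewrite eq_le normr_ge0 andbT.
have c0 : 0 <= c by have := h 0; rewrite expr0 mulr1; exact: le_trans.
rewrite -[_ <= 0]negbK; apply/negP => x0.
have xp : 0 < `|x| by rewrite lt_neqAle normr_ge0 andbT eq_sym; apply: contra x0 => /eqP ->.
have [n] := half_pow_small c0 xp.
by move=> /(le_lt_trans (h n)); rewrite ltxx.
Qed.

Lemma closureP_norm (V : normedModType R[i]) (A : set V) x :
  closure A x <-> forall e : R[i], 0 < e -> exists2 y, A y & `|x - y| < e.
Proof.
split=> [clx e e0|h B /nbhs_ballP[e e0 eB]].
  have [y []] := clx _ (nbhsx_ballx x _ e0).
  by rewrite -ball_normE; exists y.
by have [y Ay xy] := h e e0; exists y; split=> //; apply: eB; rewrite -ball_normE.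
Qed.

Lemma denseP_norm (V : normedModType R[i]) (A : set V) :
  dense A <-> forall x, closure A x.
Proof.
split=> [dA x B /nbhs_ballP[e e0 eB]|h O [x Ox] oO].
  have ne : (ball x e)° !=set0 by exists x; exact: nbhsx_ballx.
  have [y [By Ay]] := dA _ ne (@open_interior _ _).
  by exists y; split=> //; apply: eB; exact: interior_subset By.
have /h[y [Ay Oy]] : nbhs x O by exact: open_nbhs_nbhs.
by exists y.
Qed.

Lemma exists_mul_lt (c e : R[i]) : 0 <= c -> 0 < e ->
  exists2 s : R[i], 0 < s & c * s < e.
Proof.
move=> c0 e0; have [n ne] := half_pow_small c0 e0.
by exists (2^-1 ^+ n) => //; rewrite exprn_gt0// invr_gt0.
Qed.

End Approx.

(** * Homomorphisms *)

(** A bounded Lie homomorphism, as a plain function: linearity is part of the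
predicate, so that homomorphisms can be given by formulas. *)
Definition lie_hom (R : realType) (L M : banachLieType R) (f : L -> M) :=
  [/\ linear f, forall x y, f (lie x y) = lie (f x) (f y) &
      exists2 c : R[i], 0 < c & forall x, `|f x| <= c * `|x| ].

(** The morphisms of the category, again as plain functions; see [rad_dense_hom]. *)
Definition dense_hom (R : realType) (L M : banachLieType R) (f : L -> M) :=
  lie_hom f /\ forall y, closure (range f) y.

Lemma rad_dense_hom (R : realType) (P : preradical R) (L M : banachLieType R)
  (f : L -> M) : dense_hom f -> forall x, ideal_set (P L) x -> ideal_set (P M) (f x).
Proof.
move=> [[fl fm fb] fd] x Px.
pose m := GRing.isLinear.Build R[i] L M _ f fl.
pose g : {linear L -> M} := HB.pack f m.
have gm : lie_morphism g by split => //; exact/denseP_norm.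
by apply: (rad_morphism gm); exists x.
Qed.

(** * The exponential of a small bounded derivation *)

Section LieBilinear.
Variables (R : realType) (L : banachLieType R).

Lemma lieZr (x y : L) (a : R[i]) : lie x (a *: y) = a *: lie x y.
Proof. by have := lie_linearr x a y 0; rewrite !addr0 lie0r addr0. Qed.

Lemma lieZl (x y : L) (a : R[i]) : lie (a *: x) y = a *: lie x y.
Proof. by have := lie_linearl y a x 0; rewrite !addr0 lie0l addr0. Qed.

Lemma lie_sum (I J : Type) (r : seq I) (s : seq J) (F : I -> L) (G : J -> L) :
  lie (\sum_(i <- r) F i) (\sum_(j <- s) G j) =
  \sum_(i <- r) \sum_(j <- s) lie (F i) (G j).
Proof.
elim: r => [|i r IH]; first by rewrite !big_nil lie0l.
rewrite !big_cons lieDl IH; congr (_ + _).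
elim: s {IH} => [|j s IH]; first by rewrite !big_nil lie0r.
by rewrite !big_cons lieDr IH.
Qed.

End LieBilinear.

(** The bound [d <= 1/8] makes all estimates geometric: n ^ 2 d ^ n, the bound for the
tail of a Cauchy product, is at most 1 / 2 ^ n. *)
Section Exponential.
Variables (R : realType) (L : banachLieType R) (D : L -> L).
Hypothesis D_linear : linear D.
Hypothesis D_lie : forall x y, D (lie x y) = lie (D x) y + lie x (D y).
Variable d : R[i].
Hypothesis d_ge0 : 0 <= d.
Hypothesis d_small : d <= 8^-1.
Hypothesis D_le : forall x, `|D x| <= d * `|x|.

(** The n-th term D^n x / n! of the exponential series. *)
Fixpoint exp_term n (x : L) : L :=
  if n is m.+1 then (n%:R : R[i])^-1 *: D (exp_term m x) else x.

Definition exp_sum n (x : L) : L := \sum_(0 <= i < n) exp_term i x.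

Let D0 : D 0 = 0.
Proof. by have := D_linear (-1) 0 0; rewrite scaler0 addr0 scaleN1r addNr. Qed.

Let DD x y : D (x + y) = D x + D y.
Proof. by have := D_linear 1 x y; rewrite !scale1r. Qed.

Lemma exp_term_linear n : linear (exp_term n).
Proof.
elim: n => [//|n IH] a x y /=.
by rewrite IH D_linear scalerDr !scalerA mulrC.
Qed.

Lemma exp_sum_linear n : linear (exp_sum n).
Proof.
move=> a x y; rewrite /exp_sum scaler_sumr -big_split /=.
by apply: eq_bigr => i _; rewrite exp_term_linear.
Qed.

Lemma exp_term_le n x : `|exp_term n x| <= d ^+ n * `|x|.
Proof.
elim: n => [|n IH]; first by rewrite expr0 mul1r.
rewrite /= normrZ exprS -mulrA.
have h : `|D (exp_term n x)| <= d * (d ^+ n * `|x|).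
  by apply: le_trans (D_le _) _; rewrite ler_wpM2l.
apply: le_trans h; rewrite ler_piMl// normfV ger0_norm ?ler0n//.
by rewrite invf_le1 ?ltr0n// ler1n.
Qed.

Lemma exp_termS n x : D (exp_term n x) = n.+1%:R *: exp_term n.+1 x.
Proof. by rewrite /= scalerA divff ?scale1r// pnatr_eq0. Qed.

Arguments exp_term : simpl never.

(** The Leibniz rule for D^n / n!. *)
Lemma exp_term_lie n x y : exp_term n (lie x y) =
  \sum_(0 <= i < n.+1) lie (exp_term i x) (exp_term (n - i) y).
Proof.
elim: n => [|n IH]; first by rewrite big_nat1 subn0.
apply: (@scalerI _ _ (n.+1%:R : R[i])); first by rewrite pnatr_eq0.
rewrite -exp_termS IH.
have -> : D (\sum_(0 <= i < n.+1) lie (exp_term i x) (exp_term (n - i) y)) =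
    \sum_(0 <= i < n.+1) D (lie (exp_term i x) (exp_term (n - i) y)).
  elim: index_iota => [|i s IHs]; first by rewrite !big_nil D0.
  by rewrite !big_cons DD IHs.
have -> : (n.+1%:R : R[i]) *:
    \sum_(0 <= i < n.+2) lie (exp_term i x) (exp_term (n.+1 - i) y) =
    \sum_(0 <= i < n.+2) i%:R *: lie (exp_term i x) (exp_term (n.+1 - i) y) +
    \sum_(0 <= i < n.+2) (n.+1 - i)%:R *: lie (exp_term i x) (exp_term (n.+1 - i) y).
  rewrite -big_split /= scaler_sumr; apply: eq_big_nat => i /andP[_ i2].
  by rewrite -scalerDl -natrD subnKC.
rewrite [X in _ = X + _]big_nat_recl//= scale0r add0r.
rewrite [X in _ = _ + X]big_nat_recr//= subnn scale0r addr0.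
rewrite -big_split /=; apply: eq_big_nat => i /andP[_ i1].
rewrite D_lie exp_termS lieZl subSS; congr (_ + _).
by rewrite subSn// exp_termS lieZr.
Qed.

Lemma exp_sum_lie n x y : exp_sum n (lie x y) =
  \sum_(0 <= i < n) \sum_(0 <= j < n - i) lie (exp_term i x) (exp_term j y).
Proof.
elim: n => [|n IH]; first by rewrite /exp_sum !big_nil.
rewrite /exp_sum big_nat_recr//= -/(exp_sum n _) IH exp_term_lie.
have -> : \sum_(0 <= i < n) \sum_(0 <= j < n - i) lie (exp_term i x) (exp_term j y)
  = \sum_(0 <= i < n.+1) \sum_(0 <= j < n - i) lie (exp_term i x) (exp_term j y).
  by rewrite big_nat_recr//= subnn [X in _ + X]big_nil addr0.
rewrite -big_split /=; apply: eq_big_nat => i /andP[_ i1].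
by rewrite subSn// big_nat_recr.
Qed.

Let d_half n : n%:R * n%:R * d ^+ n <= 2^-1 ^+ n.
Proof.
have : d ^+ n <= (2^-1 ^+ n) * (2^-1 ^+ n) * (2^-1 ^+ n).
  rewrite -!exprMn; apply: lerXn2r; rewrite ?nnegrE ?d_ge0 ?mulr_ge0 ?invr_ge0//.
  by apply: le_trans d_small _; rewrite -!invfM -!natrM.
have : n%:R <= 2 ^+ n :> R[i] by rewrite -natrX ler_nat ltnW// ltn_expl.
have : 2 ^+ n * 2^-1 ^+ n = 1 :> R[i] by rewrite -exprMn divff ?expr1n// pnatr_eq0.
have : 0 <= d ^+ n by rewrite exprn_ge0.
have : 0 <= n%:R :> R[i] by [].
move: (n%:R : R[i]) (2 ^+ n : R[i]) (2^-1 ^+ n : R[i]) (d ^+ n) => N p q e.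
move=> N0 e0 pq Np eq3.
have -> : q = (p * p) * (q * q * q) by rewrite mulrA mulrACA pq !mul1r.
by rewrite ler_pM ?mulr_ge0// ler_pM.
Qed.

(** The terms of [lie (exp_sum n x) (exp_sum n y)] of total degree below n add up to
[exp_sum n (lie x y)]; at most n ^ 2 terms remain, each of degree at least n. *)
Lemma exp_sum_lie_defect x y : exists2 c : R[i], 0 <= c & forall n,
  `|lie (exp_sum n x) (exp_sum n y) - exp_sum n (lie x y)| <= c * 2^-1 ^+ n.
Proof.
have [t t0 tP] := @lie_bounded R L.
exists (t * `|x| * `|y|) => [|n]; first by rewrite !mulr_ge0// ltW.
rewrite exp_sum_lie lie_sum -sumrB.
have d1 : d <= 1 by apply: le_trans d_small _; rewrite invf_le1// ler1n.
have dn i : 0 <= d ^+ i by rewrite exprn_ge0.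
apply: (@le_trans _ _ (\sum_(0 <= i < n) \sum_(0 <= j < n) t * `|x| * `|y| * d ^+ n)).
  apply: (le_trans (ler_norm_sum _ _ _)).
  apply: ler_sum_nat => i /andP[_ i_n].
  rewrite (@big_cat_nat _ _ _ (n - i)%N) ?leq_subr//= addrAC subrr add0r.
  rewrite [leRHS](@big_cat_nat _ _ _ (n - i)%N) ?leq_subr//=.
  apply: (@le_trans _ _ (\sum_(n - i <= j < n) t * `|x| * `|y| * d ^+ n)).
    apply: (le_trans (ler_norm_sum _ _ _)).
    apply: ler_sum_nat => j /andP[nij j_n].
    apply: le_trans (tP _ _) _.
    apply: (@le_trans _ _ (t * (d ^+ i * `|x|) * (d ^+ j * `|y|))).
      by rewrite ler_pM ?mulr_ge0 ?exp_term_le ?ler_wpM2l ?exp_term_le// ltW.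
    rewrite (_ : t * _ * _ = t * `|x| * `|y| * d ^+ (i + j)); last first.
      by rewrite exprD; ring.
    rewrite ler_wpM2l ?mulr_ge0 ?(ltW t0)// ler_wiXn2l//.
    by rewrite -leq_subLR.
  rewrite lerDr sumr_ge0// => j _; rewrite !mulr_ge0//; exact: ltW.
rewrite !sumr_const_nat subn0.
rewrite (_ : _ *+ n *+ n = t * `|x| * `|y| * (n%:R * n%:R * d ^+ n)); last first.
  by rewrite -mulrnA -[LHS]mulr_natr natrM; ring.
by rewrite ler_wpM2l ?mulr_ge0 ?(ltW t0).
Qed.

Let d2 : 2 * d <= 1.
Proof.
apply: (@le_trans _ _ (2 * 8^-1)); first by rewrite ler_wpM2l.
by rewrite ler_pdivrMr// mul1r ler_nat.
Qed.

Let dn_half n : d ^+ n <= 2^-1 ^+ n.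
Proof. by apply: lerXn2r; rewrite ?nnegrE ?invr_ge0// -[2^-1]mul1r ler_pdivlMr// mulrC d2. Qed.

(** The summands of [exp_sum] are dominated by a geometric series whose ratio d
satisfies [2 * d <= 1]. *)
Lemma exp_sum_dist n k x :
  `|exp_sum (n + k) x - exp_sum n x| <= (2 * d ^+ n) * `|x|.
Proof.
suff h : `|exp_sum (n + k) x - exp_sum n x| <= (2 * d ^+ n - 2 * d ^+ (n + k)) * `|x|.
  apply: le_trans h _; rewrite ler_wpM2r// lerBlDr lerDl.
  by rewrite mulr_ge0// exprn_ge0.
elim: k => [|k IH]; first by rewrite addn0 !subrr normr0 mul0r.
rewrite addnS /exp_sum big_nat_recr//= -/(exp_sum (n + k) x) -/(exp_sum n x) addrAC.
apply: le_trans (ler_normD _ _) _.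
apply: le_trans (lerD IH (exp_term_le _ _)) _.
rewrite -mulrDl ler_wpM2r// exprS -subr_ge0.
rewrite (_ : _ - _ = d ^+ (n + k) * (1 - 2 * d)); last by ring.
by rewrite mulr_ge0 ?exprn_ge0// subr_ge0.
Qed.

Lemma exp_sum_lim x : exists y, forall n, `|y - exp_sum n x| <= (2 * d ^+ n) * `|x|.
Proof.
have small (e : R[i]) : 0 < e -> exists n, (2 * d ^+ n) * `|x| < e.
  move=> e0; have [|n ne] := @half_pow_small _ (2 * `|x|) e _ e0; first by rewrite mulr_ge0.
  by exists n; apply: le_lt_trans ne; rewrite mulrAC ler_wpM2l ?mulr_ge0 ?dn_half//.
have cx : cauchy ((fun n => exp_sum n x) @ \oo).
  apply/cauchy_exP => e /small[n ne]; exists (exp_sum n x).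
  rewrite -ball_normE; exists n => // k /= nk.
  by rewrite distrC -(subnKC nk); apply: le_lt_trans (exp_sum_dist _ _ _) ne.
have /cvg_ex[l xl] : cvg ((fun n => exp_sum n x) @ \oo) by exact: cauchy_cvg.
exists l => n; apply/ler_addgt0Pr => e e0.
move/cvgrPdist_lt : xl => /(_ _ e0)[m _ mx].
rewrite -[l](subrK (exp_sum (n + m) x)) -addrA.
apply: le_trans (ler_normD _ _) _; rewrite [leRHS]addrC lerD ?exp_sum_dist//.
by apply/ltW/mx; rewrite /= leq_addl.
Qed.

(** exp(D), the sum of the exponential series. *)
Definition exp_map x := projT1 (cid (exp_sum_lim x)).

Lemma exp_mapP n x : `|exp_map x - exp_sum n x| <= (2 * d ^+ n) * `|x|.
Proof. by rewrite /exp_map; case: cid. Qed.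

Let exp_mapP' n x : `|exp_map x - exp_sum n x| <= (2 * `|x|) * 2^-1 ^+ n.
Proof.
by apply: le_trans (exp_mapP n x) _; rewrite mulrAC ler_wpM2l ?mulr_ge0 ?dn_half//.
Qed.

Lemma exp_map_linear : linear exp_map.
Proof.
move=> a x y; apply/eqP; rewrite -subr_eq0; apply/eqP.
apply: (@le_half_pow_eq0 _ _ _ (2 * `|a *: x + y| + (`|a| * (2 * `|x|) + 2 * `|y|))) => n.
have -> : exp_map (a *: x + y) - (a *: exp_map x + exp_map y) =
   (exp_map (a *: x + y) - exp_sum n (a *: x + y)) -
   (a *: (exp_map x - exp_sum n x) + (exp_map y - exp_sum n y)).
  rewrite exp_sum_linear scalerBr addrACA -[in RHS]opprD.
  by rewrite [in RHS]opprB addrA subrK.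
apply: le_trans (ler_normB _ _) _; rewrite mulrDl lerD ?exp_mapP'//.
apply: le_trans (ler_normD _ _) _; rewrite mulrDl lerD ?exp_mapP'// normrZ -mulrA.
by rewrite ler_wpM2l ?exp_mapP'.
Qed.

Lemma exp_map_le x : `|exp_map x| <= 2 * `|x|.
Proof.
by have := exp_mapP 0 x; rewrite /exp_sum big_nil subr0 expr0 mulr1.
Qed.

Lemma exp_map_near_id x : `|exp_map x - x| <= 2^-1 * `|x|.
Proof.
have := exp_mapP 1 x; rewrite /exp_sum big_nat1 expr1 => h.
apply: le_trans h _; rewrite ler_wpM2r//.
apply: (@le_trans _ _ (2 * 8^-1)); first by rewrite ler_wpM2l.
by rewrite ler_pdivrMr// mulrC ler_pdivlMr// -natrM ler_nat.
Qed.

Lemma exp_map_first_order x : `|exp_map x - x - D x| <= (2 * d ^+ 2) * `|x|.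
Proof.
have := exp_mapP 2 x; rewrite /exp_sum big_nat_recr//= big_nat1.
by rewrite {2}/exp_term invr1 scale1r opprD addrA.
Qed.

Lemma exp_map_lie x y : exp_map (lie x y) = lie (exp_map x) (exp_map y).
Proof.
have [t t0 tP] := @lie_bounded R L.
have [c c0 cP] := exp_sum_lie_defect x y.
apply/eqP; rewrite -subr_eq0; apply/eqP.
apply: (@le_half_pow_eq0 _ _ _
  (2 * `|lie x y| + (c + (t * (4 * `|x|) * (2 * `|y|) + t * (2 * `|x|) * (2 * `|y|))))) => n.
have sx : `|exp_sum n x| <= 4 * `|x|.
  rewrite -[exp_sum n x](subKr (exp_map x)) (le_trans (ler_normB _ _))//.
  have -> : 4 * `|x| = 2 * `|x| + 2 * `|x| by rewrite -mulrDl -natrD.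
  rewrite lerD ?exp_map_le//.
  apply: le_trans (exp_mapP' _ _) _; rewrite ler_piMr ?mulr_ge0//.
  by rewrite exprn_ile1 ?invr_ge0 ?invf_le1 ?ler1n.
set e1 := exp_map _; set s1 := exp_sum n (lie x y).
have -> : e1 - lie (exp_map x) (exp_map y) = (e1 - s1) -
    ((lie (exp_sum n x) (exp_sum n y) - s1) +
     (lie (exp_sum n x) (exp_map y - exp_sum n y) +
      lie (exp_map x - exp_sum n x) (exp_map y))).
  rewrite lieBr lieBl.
  move: (lie (exp_sum n x) (exp_sum n y)) (lie (exp_sum n x) (exp_map y)).
  move: (lie (exp_map x) (exp_map y)) => u v w.
  have -> : v - s1 + (w - v + (u - w)) = u - s1.
    by rewrite [w - v + _]addrC subrKA addrC subrKA.
  by rewrite opprB subrKA.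
apply: le_trans (ler_normB _ _) _; rewrite mulrDl lerD ?exp_mapP'//.
apply: le_trans (ler_normD _ _) _; rewrite mulrDl lerD//.
apply: le_trans (ler_normD _ _) _; rewrite mulrDl lerD//.
  apply: le_trans (tP _ _) _; rewrite -[leRHS]mulrA.
  by apply: ler_pM; rewrite ?mulr_ge0 ?ler_wpM2l ?exp_mapP' ?(ltW t0).
apply: le_trans (tP _ _) _.
rewrite (_ : _ * _ * 2^-1 ^+ n = t * ((2 * `|x|) * 2^-1 ^+ n) * (2 * `|y|)); last by ring.
by apply: ler_pM; rewrite ?mulr_ge0 ?ler_wpM2l ?exp_mapP' ?exp_map_le ?(ltW t0).
Qed.

(** As exp(D) is at distance at most 1/2 from the identity, the iterates of
1 - exp(D) tend to 0, and y differs from each of them by an element of the range. *)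
Lemma exp_map_dense y : closure (range exp_map) y.
Proof.
have exp_mapD u v : exp_map (u + v) = exp_map u + exp_map v.
  by have := exp_map_linear 1 u v; rewrite !scale1r.
pose r k := iter k (fun z => z - exp_map z) y.
have rn k : `|r k| <= `|y| * 2^-1 ^+ k.
  elim: k => [|k IH]; first by rewrite expr0 mulr1.
  rewrite /= distrC (le_trans (exp_map_near_id _))// exprS mulrCA.
  by rewrite ler_wpM2l ?invr_ge0.
have rr k : range exp_map (y - r k).
  elim: k => [|k [z _ zE]].
    by exists 0 => //; rewrite subrr; apply: (@addrI _ (exp_map 0)); rewrite -exp_mapD !addr0.
  by exists (z + r k) => //; rewrite exp_mapD zE /r /= opprB addrAC addrA.
apply/closureP_norm => e e0; have [n ne] := half_pow_small (normr_ge0 y) e0.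
by exists (y - r n) => //; rewrite subKr; exact: le_lt_trans (rn n) ne.
Qed.

Lemma exp_map_dense_hom : dense_hom exp_map.
Proof.
split; last exact: exp_map_dense.
split; [exact: exp_map_linear|exact: exp_map_lie|].
by exists 2 => // x; exact: exp_map_le.
Qed.

End Exponential.

(** A preradical is preserved by bounded derivations. *)
Lemma rad_derivation (R : realType) (P : preradical R) (L : banachLieType R)
    (D : L -> L) (c : R[i]) :
  linear D -> (forall x y, D (lie x y) = lie (D x) y + lie x (D y)) ->
  0 < c -> (forall x, `|D x| <= c * `|x|) ->
  forall x, ideal_set (P L) x -> ideal_set (P L) (D x).
Proof.
move=> Dlin Dlie c0 Dc x Px.
have [[P0 PD cP] _] := idealP (P L).
apply: cP; apply/closureP_norm => e e0.
have e1 : 0 <= 8 * c + 2 * c ^+ 2 * `|x| / e.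
  by rewrite addr_ge0 ?mulr_ge0 ?exprn_ge0 ?invr_ge0// ltW.
(* s makes both s c at most 1/8 and the remainder 2 s c^2 |x| less than e. *)
have [s s0 sP] := exists_mul_lt e1 (@ltr01 R[i]).
have s1 : s * c <= 8^-1.
  rewrite -[8^-1]mul1r ler_pdivlMr// ltW//; apply: le_lt_trans sP.
  rewrite (_ : s * c * 8 = 8 * c * s) ?[leRHS]mulrDl ?lerDl; last by ring.
  by rewrite !mulr_ge0 ?exprn_ge0 ?invr_ge0// ltW.
have s2 : 2 * c ^+ 2 * `|x| * s < e.
  rewrite -[ltRHS]mul1r -ltr_pdivrMr//; apply: le_lt_trans sP.
  rewrite [leLHS]mulrAC [leRHS]mulrDl lerDr.
  by rewrite !mulr_ge0// ltW.
pose Ds z := s *: D z.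
have Dslin : linear Ds by move=> a u v; rewrite /Ds Dlin scalerDr !scalerA mulrC.
have Dslie u v : Ds (lie u v) = lie (Ds u) v + lie u (Ds v).
  by rewrite /Ds Dlie scalerDr lieZl lieZr.
have Dsc z : `|Ds z| <= (s * c) * `|z|.
  by rewrite /Ds normrZ gtr0_norm// -mulrA ler_wpM2l// ltW.
have sc0 : 0 <= s * c by rewrite mulr_ge0// ltW.
pose f := exp_map sc0 s1 Dsc.
have Pf : ideal_set (P L) (f x).
  exact: (rad_dense_hom (exp_map_dense_hom Dslin Dslie sc0 s1 Dsc) Px).
exists (s^-1 *: (f x - x)).
  rewrite -[_ *: _]addr0; apply: (PD) => //.
  by rewrite addrC -scaleN1r; exact: PD.
have := exp_map_first_order sc0 s1 Dsc x; rewrite -/f /Ds => h.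
rewrite distrC (_ : _ - _ = s^-1 *: (f x - x - s *: D x)); last first.
  by rewrite [in RHS]scalerBr scalerA mulVf ?scale1r// gt_eqF.
rewrite normrZ gtr0_norm ?invr_gt0//; apply: le_lt_trans s2.
rewrite ler_pdivrMl//; apply: le_trans h _.
by rewrite le_eqVlt; apply/orP; left; apply/eqP; ring.
Qed.

(** * Constructions on homomorphisms and ideals *)

Section Homs.
Variable R : realType.
Implicit Types L M N : banachLieType R.

(** A map with values in a closed subalgebra, regarded as a map into it. *)
Definition corestr L M (A : closedSubalgebra M) (f : L -> M)
  (fA : forall x, subalgebra_set A (f x)) (x : L) : sublie A :=
  exist _ (f x) (mem_set (fA x)).

Section HomTheory.
Variables (L M : banachLieType R) (f : L -> M).
Hypothesis fhom : lie_hom f.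

Lemma lie_homB x y : f (x - y) = f x - f y.
Proof. by have [fl _ _] := fhom; have := fl (-1) y x; rewrite !scaleN1r ![- _ + _]addrC. Qed.

Lemma lie_hom0 : f 0 = 0.
Proof. by rewrite -(subrr 0) lie_homB subrr. Qed.

Lemma lie_hom_closure (A : set L) x : closure A x -> closure (f @` A) (f x).
Proof.
have [_ _ [c c0 fc]] := fhom.
move=> /closureP_norm h; apply/closureP_norm => e e0.
have [|y Ay xy] := h (e / c); first by rewrite divr_gt0.
exists (f y); first by exists y.
by rewrite -lie_homB (le_lt_trans (fc _))// mulrC -ltr_pdivlMr.
Qed.

Lemma preimage_ideal (J : closedIdeal M) : closed_lie_ideal (f @^-1` ideal_set J).
Proof.
have [fl fm _] := fhom; have [[J0 JD cJ] lJ] := idealP J.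
split; first split.
- by rewrite /= lie_hom0.
- by move=> a x y Jx Jy; rewrite /= fl; exact: JD.
- move=> x clx; apply: cJ; apply: (@closure_subset _ (f @` (f @^-1` ideal_set J))).
    by move=> _ [y Jy <-].
  exact: lie_hom_closure.
- by move=> x y Jy; rewrite /= fm; exact: lJ.
Qed.

Lemma corestr_hom (A : closedSubalgebra M) (fA : forall x, subalgebra_set A (f x)) :
  lie_hom (corestr fA).
Proof.
have [fl fm [c c0 fc]] := fhom; split.
- by move=> a x y; apply/val_inj; rewrite [RHS]linearP; exact: fl.
- by move=> x y; apply/val_inj; exact: fm.
- by exists c => // x; exact: fc.
Qed.

Lemma corestr_dense_hom (A : closedSubalgebra M) (fA : forall x, subalgebra_set A (f x)) :
  (forall y, subalgebra_set A y -> closure (range f) y) -> dense_hom (corestr fA).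
Proof.
move=> fd; split; first exact: corestr_hom.
move=> y; apply/closureP_norm => e e0.
have /closureP_norm/(_ _ e0)[_ [z _ <-] yz] := fd _ (sublieP y).
exists (corestr fA z); first by exists z.
by rewrite sublie_normB.
Qed.

End HomTheory.

Lemma comp_hom L M N (f : L -> M) (g : M -> N) :
  lie_hom f -> lie_hom g -> lie_hom (g \o f).
Proof.
move=> [fl fm [c c0 fc]] [gl gm [d d0 gd]]; split.
- by move=> a x y; rewrite /= fl gl.
- by move=> x y; rewrite /= fm gm.
- exists (d * c) => [|x]; first exact: mulr_gt0.
  by rewrite /= (le_trans (gd _))// -mulrA ler_wpM2l// ltW.
Qed.

Lemma comp_dense_hom L M N (f : L -> M) (g : M -> N) :
  dense_hom f -> dense_hom g -> dense_hom (g \o f).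
Proof.
move=> [fh fd] [gh gd]; split; first exact: comp_hom.
move=> z; apply: closed_closure.
apply: (closure_subset _ (gd z)) => _ [y _ <-].
by apply: closure_subset (lie_hom_closure gh (fd y)) => _ [_ [x _ <-] <-]; exists x.
Qed.

Lemma surj_dense_hom L M (f : L -> M) :
  lie_hom f -> (forall y, exists x, f x = y) -> dense_hom f.
Proof.
by move=> fh fs; split=> // y; apply: subset_closure; have [x <-] := fs y; exists x.
Qed.

Lemma incl_hom L (A : closedSubalgebra L) : lie_hom (@Defs.incl R L A).
Proof.
split; [by move=> a x y; rewrite /Defs.incl linearP|by []|].
by exists 1 => // x; rewrite mul1r.
Qed.

Lemma quotmap_hom L (I : closedIdeal L) : lie_hom (quotmap I).
Proof.
split; [exact: quotmap_linear|exact: quotmap_lie|].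
by exists 1 => // x; rewrite mul1r quotmap_norm_le.
Qed.

Lemma quotmap_dense_hom L (I : closedIdeal L) : dense_hom (quotmap I).
Proof.
by apply: surj_dense_hom (quotmap_hom I) _ => u; exists (repr u); exact: quotmap_repr.
Qed.

(** Every class of a quotient has a representative of comparable norm. *)
Lemma quotmap_lift L (I : closedIdeal L) (u : quotlie I) :
  exists2 x, quotmap I x = u & `|x| <= 2 * `|u|.
Proof.
have [->|u0] := eqVneq u 0.
  by exists 0; rewrite ?quotmap0// !normr0 mulr0.
pose S : set R := [set complex.Re `|x| | x in [set x : L | quotmap I x = u]].
have uE : `|u| = (inf S)%:C%C by [].
have i0 : 0 < inf S.
  by rewrite -ltcR -uE normr_gt0.
have Sinf : has_inf S.
  split; first by exists (complex.Re `|repr u|), (repr u) => //; exact: quotmap_repr.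
  exists 0 => _ [x _ <-]; have := normr_ge0 x; rewrite lecE => /andP[_ //].
have [_ [x xu <-] xe] := inf_adherent i0 Sinf.
exists x => //; rewrite uE.
have -> : `|x| = (complex.Re `|x|)%:C%C by rewrite RRe_real// realE normr_ge0.
by rewrite -[2](rmorph_nat (real_complex R) 2) -rmorphM /= lecR mulr2n mulrDl mul1r ltW.
Qed.

(** Factorization through a surjection with bounded lifts, which are required
explicitly instead of being drawn from the open mapping theorem. *)
Lemma dense_hom_factor L M N (f : L -> M) (g : L -> N) :
  dense_hom f -> lie_hom g ->
  (exists2 c : R[i], 0 < c & forall z, exists2 x, g x = z & `|x| <= c * `|z|) ->
  (forall x, g x = 0 -> f x = 0) ->
  exists2 h : N -> M, dense_hom h & forall x, h (g x) = f x.
Proof.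
move=> [fh fd] gh [c c0 glift] gf.
have [fl fm [d d0 fb]] := fh; have [gl gm _] := gh.
have fg x y : g x = g y -> f x = f y.
  move=> gxy; apply/eqP; rewrite -subr_eq0 -lie_homB//; apply/eqP/gf.
  by rewrite lie_homB// gxy subrr.
pose l z := s2val (cid2 (glift z)).
have gK z : g (l z) = z by rewrite /l; case: cid2.
have lb z : `|l z| <= c * `|z| by rewrite /l; case: cid2.
have lE x : f (l (g x)) = f x by apply: fg; exact: gK.
exists (f \o l) => //; split.
  split.
  - by move=> a x y /=; rewrite -fl; apply: fg; rewrite gl !gK.
  - by move=> x y /=; rewrite -fm; apply: fg; rewrite gm !gK.
  - exists (d * c) => [|x]; first exact: mulr_gt0.
    by rewrite /= (le_trans (fb _))// -mulrA ler_wpM2l// ltW.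
move=> y; apply: closure_subset (fd y) => _ [x _ <-].
by exists (g x) => //; exact: lE.
Qed.

(** Density of the range makes the closure stable under brackets with all of [M]. *)
Lemma closure_image_ideal L M (f : L -> M) (J : closedIdeal L) :
  dense_hom f -> closed_lie_ideal (closure (f @` ideal_set J)).
Proof.
move=> [fh fd]; have [fl fm _] := fh; have [[J0 JD _] lJ] := idealP J.
split; first split.
- by apply: subset_closure; exists 0 => //; exact: lie_hom0.
- move=> a x y /closureP_norm clx /closureP_norm cly; apply/closureP_norm => e e0.
  have e20 : 0 < e / 2 by rewrite divr_gt0.
  have [d d0 da] := exists_mul_lt (normr_ge0 a) e20.
  have [_ [x' Jx <-] xx'] := clx _ d0.
  have [_ [y' Jy <-] yy'] := cly _ e20.
  exists (f (a *: x' + y')); first by exists (a *: x' + y') => //; exact: JD.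
  rewrite fl opprD addrACA -scalerBr (le_lt_trans (ler_normD _ _))//.
  rewrite [e]splitr ltrD// normrZ (le_lt_trans _ da)// ler_wpM2l//.
  exact: ltW.
- exact: closed_closure.
- move=> x y /closureP_norm cly; apply/closureP_norm => e e0.
  have [t t0 tP] := @lie_bounded R M.
  have e20 : 0 < e / 2 by rewrite divr_gt0.
  have c1 : 0 <= t * `|x| by rewrite mulr_ge0// ltW.
  (* y is approximated first: how well x must be approximated depends on f y'. *)
  have [d d0 de] := exists_mul_lt c1 e20.
  have [_ [y' Jy <-] yy'] := cly _ d0.
  have c2 : 0 <= t * `|f y'| by rewrite mulr_ge0// ltW.
  have [d' d'0 d'e] := exists_mul_lt c2 e20.
  have /closureP_norm/(_ _ d'0)[_ [x' _ <-] xx'] := fd x.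
  exists (f (lie x' y')); first by exists (lie x' y') => //; exact: lJ.
  have -> : lie x y - f (lie x' y') = lie x (y - f y') + lie (x - f x') (f y').
    by rewrite fm lieBr lieBl addrA subrK.
  rewrite (le_lt_trans (ler_normD _ _))// [e]splitr ltrD//.
    by rewrite (le_lt_trans (tP _ _))// (le_lt_trans _ de)// ler_wpM2l// ltW.
  rewrite (le_lt_trans (tP _ _))// (le_lt_trans _ d'e)// mulrAC ler_wpM2l//.
  exact: ltW.
Qed.

End Homs.

(** * The value of a preradical on a subalgebra *)

Section RadIn.
Variables (R : realType) (P : preradical R).
Implicit Types L M N : banachLieType R.

(** [P (sublie A)] as a subset of [L]. *)
Definition rad_in L (A : closedSubalgebra L) : set L := @Defs.incl R L A @` P (sublie A).

Lemma rad_in_sub L (A : closedSubalgebra L) : rad_in A `<=` A.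
Proof. by move=> _ [x _ <-]; exact: sublieP. Qed.

Lemma rad_hom_into L M (A : closedSubalgebra L) (f : M -> L) :
  lie_hom f -> (forall x, subalgebra_set A (f x)) ->
  (forall y, subalgebra_set A y -> closure (range f) y) ->
  forall x, ideal_set (P M) x -> rad_in A (f x).
Proof.
move=> fh fA fd x Px.
exists (corestr fA x) => //.
exact: (rad_dense_hom (corestr_dense_hom fh fA fd) Px).
Qed.

(** The bracket with an element of [L] restricts to a bounded derivation of the
ideal [A]. *)
Lemma rad_in_ideal L (A : closedSubalgebra L) :
  closed_lie_ideal A -> closed_lie_ideal (rad_in A).
Proof.
move=> [_ lA]; have [sA _] := rad_subalgebra P A; split=> // x _ [y Py <-].
have [t t0 tP] := @lie_bounded R L.
have lxA (z : sublie A) : subalgebra_set A (lie x (val z)) by apply: lA; exact: sublieP.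
pose D (z : sublie A) : sublie A := exist _ (lie x (val z)) (mem_set (lxA z)).
(* The summand 1 makes the bound positive even for x = 0. *)
exists (D y) => //; apply: (@rad_derivation _ _ _ _ (t * (`|x| + 1))) => //.
- by move=> a u v; apply/val_inj; rewrite [RHS]linearP -lie_linearr -linearP.
- move=> u v; apply/val_inj; rewrite [RHS]linearD /=.
  have /eqP := lie_jacobi x (val u) (val v).
  rewrite -addrA addr_eq0 => /eqP ->; rewrite opprD addrC.
  congr (_ + _); first by rewrite -lieC.
  by rewrite [lie x (val v)]lieC -[- lie (val v) x]sub0r lieBr lie0r sub0r.
- by rewrite mulr_gt0// ltr_wpDl.
- move=> z; apply: le_trans (tP _ _) _.
  by rewrite ler_wpM2r// ler_wpM2l ?(ltW t0)// lerDl.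
Qed.

(** Balancedness for an ideal given as the closure of the range of a homomorphism. *)
Lemma balanced_hom L M (I : closedIdeal L) (f : M -> L) : balanced P ->
  lie_hom f -> (forall x, ideal_set I (f x)) ->
  (forall y, ideal_set I y -> closure (range f) y) ->
  forall x, ideal_set (P M) x -> ideal_set (P L) (f x).
Proof. by move=> bP fh fI fd x Px; apply: bP; exact: (@rad_hom_into _ _ I f). Qed.

Lemma rad_in_mono L (A B : closedSubalgebra L) : balanced P ->
  closed_lie_ideal A -> A `<=` B -> rad_in A `<=` rad_in B.
Proof.
move=> bP iA AB _ [x Px <-].
have fB (z : sublie A) : subalgebra_set B (Defs.incl z) by apply: AB; exact: sublieP.
exists (corestr fB x) => //.
pose I := ClosedIdeal (preimage_ideal (@incl_hom R L B) (ClosedIdeal iA)).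
apply: (@balanced_hom _ _ I (corestr fB) _ _ _ _ _ Px) => //.
- exact/corestr_hom/incl_hom.
- by move=> z; exact: (sublieP z).
- move=> y Iy; apply: subset_closure; exists (exist _ (Defs.incl y) (mem_set Iy)) => //.
  exact: val_inj.
Qed.

End RadIn.

(** * Well-ordered sets *)

Section Wosets.

Lemma wo_lt_trans (W : woset) (a b c : W) : wo_lt a b -> wo_lt b c -> wo_lt a c.
Proof.
move=> ab bc.
have [ca|nca] := boolP (wo_le c a).
  exfalso.
  pose A : {pred W} := [pred x | (x == a) || (x == b) || (x == c)].
  have [|m [[Am mP] _]] := @wo_leP W A; first by exists a; rewrite inE eqxx.
  move: Am; rewrite !inE => /orP[/orP[]|] /eqP mE; subst m.
  - have := mP c; rewrite inE eqxx !orbT => /(_ isT) ac.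
    have ac' : a = c by apply: wo_le_anti; rewrite ac ca.
    by move: (wo_ltNle ab); rewrite ac'; move/andP: bc => [_ ->].
  - have := mP a; rewrite inE eqxx => /(_ isT); apply/negP/wo_ltNle/ab.
  - have := mP b; rewrite inE eqxx orbT => /(_ isT); apply/negP/wo_ltNle/bc.
move: (wo_le_total a c) (nca); rewrite (negbTE nca) orbF => ac _.
rewrite /wo_lt /= ac andbT; apply: contraNneq nca => ->.
by move: (wo_le_total c c); rewrite orbb.
Qed.

Lemma wo_leNlt (W : woset) (a b : W) : ~~ wo_le a b -> wo_lt b a.
Proof.
move=> nab; move: (wo_le_total a b); rewrite (negbTE nab) /= => ba.
rewrite /wo_lt /= ba andbT; apply: contraNneq nab => ->.
by move: (wo_le_total a a); rewrite orbb.
Qed.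

Lemma wo_le_lt (W : woset) (a b : W) : wo_le a b -> a = b \/ wo_lt a b.
Proof. by move=> ab; have [->|ne] := eqVneq a b; [left|right; rewrite /wo_lt /= ne]. Qed.

Section Sum.
Variables V W : woset.

Definition wo_sum_le : rel (V + W)%type := fun x y =>
  match x, y with
  | inl a, inl b => wo_le a b
  | inl _, inr _ => true
  | inr _, inl _ => false
  | inr a, inr b => wo_le a b
  end.

Lemma wo_sum_leP : well_order wo_sum_le.
Proof.
apply: antisymmetric_well_order.
  by move=> [a|a] [b|b] //= /wo_le_anti ->.
move=> A [x Ax].
have [[v Av]|nV] := pselect (exists v, inl v \in A).
  have [|m [[Am mP] _]] := @wo_leP V [pred v | inl v \in A]; first by exists v.
  exists (inl m); split=> //; move=> [b|b] //= Ab; exact: mP.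
case: x Ax => [v|w] Aw; first by case: nV; exists v.
have [|m [[Am mP] _]] := @wo_leP W [pred v | inr v \in A]; first by exists w.
exists (inr m); split=> //; move=> [b|b] //= Ab; last exact: mP.
by case: nV; exists b.
Qed.

(** The well-ordered sum: a copy of [V] followed by a copy of [W]. *)
Definition wo_sum : woset := Woset wo_sum_leP.

End Sum.

End Wosets.

(** * Stable values of transfinite chains *)

(** [le] orders [T] so that the chain increases, and is the reverse inclusion for a
decreasing chain of subsets; [inv] is a property of all terms of the chain, on which
alone [s] needs to be inflationary and monotone; [e] sends a term to the set it
carries. *)
Section Transfinite.
Variables (T X : Type) (z : T) (s : T -> T) (l : set T -> T).
Variables (le : T -> T -> Prop) (inv : T -> Prop) (e : T -> set X).
Hypothesis le_refl : forall t, le t t.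
Hypothesis le_trans : forall t u v, le t u -> le u v -> le t v.
Hypothesis inv_z : inv z.
Hypothesis inv_s : forall t, inv t -> inv (s t).
Hypothesis z_le : forall t, le z t.
Hypothesis s_infl : forall t, inv t -> le t (s t).
Hypothesis s_mono : forall t u, inv t -> inv u -> le t u -> le (s t) (s u).
Hypothesis l_sup : forall S : set T, S !=set0 -> (forall t, S t -> inv t) ->
  (forall t u, S t -> S u -> le t u \/ le u t) ->
  [/\ inv (l S), forall t, S t -> le t (l S) &
      forall u, (forall t, S t -> le t u) -> le (l S) u].
Hypothesis e_eq : forall t u, le t u -> le u t -> e t = e u.
Hypothesis e_inj : forall t u, e t = e u -> le t u.

Notation C := (@transfinite T z s l _).

Lemma transfinite_step_le (W : woset) (a : W) :
  inv (C a) /\ forall b, wo_lt b a -> le (s (C b)) (C a).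
Proof.
elim: {a}(wo_lt_wf a) => a _ IH.
have [[c ca]|nS] := pselect (exists c, wo_succ c a).
  rewrite (transfiniteS _ _ _ ca); have [ic lc] := IH _ ca.1.
  split=> [|b ba]; first exact: inv_s.
  have [->|bc] := wo_le_lt (ca.2 _ ba); first exact: le_refl.
  have [ib _] := IH _ ba.
  by apply: le_trans (lc _ bc) _; exact: s_infl.
have [a0|na0] := pselect (exists b, wo_lt b a); last first.
  rewrite transfinite0 => [|b]; last by apply/negP => ba; apply: na0; exists b.
  by split=> // b ba; case: na0; exists b.
rewrite transfinite_lim//; last by move=> b ba; apply: nS; exists b.
have [||| il lub _] := @l_sup ((fun b : W => C b) @` [set b | wo_lt b a]).
- by have [b ba] := a0; exists (C b), b.
- by move=> _ [b ba <-]; have [] := IH b ba.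
- have h b c : wo_lt b a -> wo_lt c a -> wo_le b c -> le (C b) (C c).
    move=> ba ca /wo_le_lt[->|bc]; first exact: le_refl.
    have [ib _] := IH b ba; have [_ lc] := IH c ca.
    exact: le_trans (s_infl ib) (lc _ bc).
  move=> _ _ [b ba <-] [c ca <-].
  by case/orP: (wo_le_total b c) => bc; [left|right]; apply: h.
split=> // b ba.
have [c ca bc] : exists2 c, wo_lt c a & wo_lt b c.
  apply: contrapT => nc; apply: nS; exists b; split=> // c ca.
  by apply: contrapT => /negP ncb; apply: nc; exists c => //; exact: wo_leNlt.
have [_ lc] := IH c ca.
by apply: le_trans (lc _ bc) _; apply: lub; exists c.
Qed.

Lemma transfinite_inv (W : woset) (a : W) : inv (C a).
Proof. by have [] := transfinite_step_le a. Qed.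

Lemma transfinite_mono (W : woset) (a b : W) : wo_lt b a -> le (C b) (C a).
Proof.
move=> ba; have [_ h] := transfinite_step_le a.
exact: le_trans (s_infl (transfinite_inv b)) (h _ ba).
Qed.

Lemma transfinite_sup (W : woset) (a : W) : (exists b, wo_lt b a) ->
  (forall b, ~ wo_succ b a) ->
  forall u, (forall b, wo_lt b a -> le (C b) u) -> le (C a) u.
Proof.
move=> a0 aS u hu; rewrite transfinite_lim//.
have [||| _ _ h] := @l_sup ((fun b : W => C b) @` [set b | wo_lt b a]).
- by have [b ba] := a0; exists (C b), b.
- by move=> _ [b ba <-]; exact: transfinite_inv.
- have h b c : wo_le b c -> le (C b) (C c).
    by move=> /wo_le_lt[->|bc]; [exact: le_refl|exact: transfinite_mono].
  move=> _ _ [b ba <-] [c ca <-].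
  by case/orP: (wo_le_total b c) => bc; [left|right]; apply: h.
by apply: h => _ [b ba <-]; exact: hu.
Qed.

(** The chain is monotone in the ordinals: [f] need not map onto an initial segment. *)
Lemma transfinite_embed (V W : woset) (f : V -> W) (a : V) (b : W) :
  (forall x, wo_lt x a -> wo_lt (f x) b) ->
  (forall x y, wo_lt y a -> wo_lt x y -> wo_lt (f x) (f y)) ->
  le (C a) (C b).
Proof.
elim: {a}(wo_lt_wf a) b => a _ IH b fb fm.
have fle c : wo_lt c a -> le (C c) (C (f c)).
  move=> ca; apply: IH => // [x xc|x y yc xy]; first exact: fm.
  by apply: fm => //; exact: wo_lt_trans yc ca.
have [[c ca]|nS] := pselect (exists c, wo_succ c a).
  rewrite (transfiniteS _ _ _ ca).
  have [_ h] := transfinite_step_le b.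
  apply: le_trans (h _ (fb _ ca.1)); apply: s_mono; try exact: transfinite_inv.
  exact: fle ca.1.
have [a0|na0] := pselect (exists b, wo_lt b a); last first.
  by rewrite transfinite0 => [|c]; [exact: z_le|apply/negP => ca; apply: na0; exists c].
apply: transfinite_sup => // [c ca|c ca]; first by apply: nS; exists c.
exact: le_trans (fle _ ca) (transfinite_mono (fb _ ca)).
Qed.

Lemma transfinite_le (W : woset) (a : W) u : inv u -> le (s u) u -> le (C a) u.
Proof.
move=> iu su; elim: {a}(wo_lt_wf a) => a _ IH.
have [[c ca]|nS] := pselect (exists c, wo_succ c a).
  rewrite (transfiniteS _ _ _ ca); apply: le_trans su; apply: s_mono => //.
    exact: transfinite_inv.
  exact: IH ca.1.
have [a0|na0] := pselect (exists b, wo_lt b a); last first.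
  by rewrite transfinite0 => [|c]; [exact: z_le|apply/negP => ca; apply: na0; exists c].
by apply: transfinite_sup => // c ca; apply: nS; exists c.
Qed.

(** Along a well-order on the sets of subsets of [X], a chain that never stops would
be an injection into the subsets of [X], against Cantor's theorem. *)
Lemma transfinite_stops : exists (W : woset) (a : W), le (s (C a)) (C a).
Proof.
pose E : eqType := set (set X).
have [r rP] := well_ordering_principle E.
pose W := Woset rP; exists W; apply: contrapT => na.
have inj (a b : W) : e (C a) = e (C b) -> a = b.
  wlog ab : a b / wo_le a b.
    by case/orP: (wo_le_total a b) => ab h eab; [|symmetry]; apply: h.
  case: (wo_le_lt ab) => // {}ab eab; exfalso; apply: na; exists a.
  have [_ h] := transfinite_step_le b.
  by apply: le_trans (h _ ab) _; apply: e_inj.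
pose A : set (set X) := [set Y | exists2 a : W, e (C a) = Y & ~ (a : set (set X)) Y].
have [AA|nAA] := pselect (A (e (C (A : W)))).
  by have [a /inj aE na'] := AA; rewrite aE in na'.
by apply: (nAA); exists (A : W).
Qed.

(** The stable value exists and is the least fixed point of [s]. *)
Lemma stable_value_transfinite : exists t, [/\ inv t, le (s t) t,
  stable_value (fun a => e (@transfinite T z s l _ (ord_point a))) = e t &
  forall u, inv u -> le (s u) u -> le t u].
Proof.
have [W [a sa]] := transfinite_stops.
exists (C a); split=> //; [exact: transfinite_inv| |]; last first.
  by move=> u iu su; exact: transfinite_le.
have top (V : woset) (b : V) : le (C b) (C a).
  by apply: transfinite_le => //; exact: transfinite_inv.
apply/seteqP; split=> x.
  move=> [[V b] bst]; rewrite /=.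
  have -> : e (C b) = e (C a); last by [].
  (* b is stable, and at the copy of a in the sum of V and W, which is beyond b,
     the chain has again reached its top. *)
  pose c : wo_sum V W := inr a.
  have bc : ord_le (OrdinalNumber b) (OrdinalNumber c).
    by exists (fun x => inl x : wo_sum V W); split.
  rewrite -(bst _ bc) /=; apply: e_eq => //.
  by apply: (@transfinite_embed _ _ (fun x => inr x : wo_sum V W)).
move=> ex; exists (OrdinalNumber a) => // -[V b] [f [fb fm]] /=.
apply: e_eq => //; exact: transfinite_embed fb fm.
Qed.

End Transfinite.

(** * Quotients and their subalgebras *)

Section Common.
Variable R : realType.
Implicit Types L M N : banachLieType R.

Lemma lie_morphism_dense_hom L M (f : {linear L -> M}) :
  lie_morphism f -> dense_hom f.
Proof.
move=> [fm fb fd]; split; last exact/denseP_norm.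
by split=> //; exact: linearP.
Qed.

Lemma id_hom L : lie_hom (@id L).
Proof. by split=> //; exists 1 => // x; rewrite mul1r. Qed.

Lemma rad_in_incl (P : preradical R) L (A : closedSubalgebra L) (x : sublie A) :
  rad_in P A (Defs.incl x) -> ideal_set (P (sublie A)) x.
Proof. by move=> [y Py /val_inj <-]. Qed.

Lemma rad_in_closed (P : preradical R) L (A : closedSubalgebra L) :
  closed (rad_in P A).
Proof. by have [[]] := rad_subalgebra P A. Qed.

Lemma quotmap_factor L (I J : closedIdeal L) : I `<=` J ->
  exists2 h : quotlie I -> quotlie J,
    dense_hom h & forall x, h (quotmap I x) = quotmap J x.
Proof.
move=> IJ; apply: dense_hom_factor.
- exact: quotmap_dense_hom.
- exact: quotmap_hom.
- by exists 2 => // u; exact: quotmap_lift.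
- by move=> x /quotmap_eq0 Ix; apply/quotmap_eq0; exact: IJ.
Qed.

(** The quotient map from the preimage A of B onto B. *)
Lemma quotmap_restr L (I : closedIdeal L) (A : closedSubalgebra L)
    (B : closedSubalgebra (quotlie I)) :
  (forall x, subalgebra_set A x <-> subalgebra_set B (quotmap I x)) ->
  exists g : sublie A -> sublie B,
    [/\ lie_hom g, forall x, Defs.incl (g x) = quotmap I (Defs.incl x) &
        exists2 c : R[i], 0 < c & forall z, exists2 x, g x = z & `|x| <= c * `|z| ].
Proof.
move=> AB.
have gB (x : sublie A) : subalgebra_set B ((quotmap I \o @Defs.incl R L A) x).
  by apply/AB; exact: sublieP.
exists (corestr gB); split=> //.
  by apply/corestr_hom/comp_hom; [exact: incl_hom|exact: quotmap_hom].
exists 2 => // z; have [x xz xle] := quotmap_lift (Defs.incl z).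
have Ax : subalgebra_set A x by apply/AB; rewrite xz; exact: sublieP.
exists (exist _ x (mem_set Ax)) => //; exact: val_inj.
Qed.

End Common.

(** * The least ideal modulo which a preradical vanishes *)

Section Star.
Variables (R : realType) (P : preradical R).
Implicit Types L M N : banachLieType R.

Lemma rad_star_spec L : exists J : closedIdeal L,
  [/\ rad_star P L = J, forall u, ideal_set (P (quotlie J)) u -> u = 0 &
      forall K : closedIdeal L, (forall u, ideal_set (P (quotlie K)) u -> u = 0) ->
        J `<=` K].
Proof.
pose s (I : closedIdeal L) := ClosedIdeal (rad_quot_ideal P I).
have sP (I : closedIdeal L) :
    s I `<=` I <-> forall u, ideal_set (P (quotlie I)) u -> u = 0.
  split=> h => [u|x].
    rewrite -(quotmap_repr u) => Pu; apply/quotmap_eq0; exact: h.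
  by move=> /h /quotmap_eq0.
have [||||||||||J [_ sJ JE Jmin]] := @stable_value_transfinite (closedIdeal L) L
  (ClosedIdeal (zero_ideal L)) s
  (fun S => as_ideal (closure (\bigcup_(I in S) ideal_set I)))
  (fun I J => I `<=` J) (fun=> True) (@ideal_set R L).
- by move=> I; exact: subset_refl.
- by move=> I J K; exact: subset_trans.
- by [].
- by [].
- by move=> I x -> ; exact: ideal0.
- move=> I _ x /quotmap_eq0 Ix; rewrite /= Ix; exact: (ideal0 (P _)).
- move=> I J _ _ IJ x Px.
  have [h hd hE] := quotmap_factor IJ.
  by rewrite /= -hE; exact: rad_dense_hom.
- move=> S S0 _ Stot; rewrite /as_ideal; case: pselect; last first.
    by case; exact: closure_bigcup_ideal.
  move=> Sid; split=> // [I SI|K SK] /=.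
    by move=> x Ix; apply: subset_closure; exists I.
  have [[_ _ cK] _] := idealP K; move=> x clx; apply: cK.
  by apply: closure_subset clx => y [I SI Iy]; exact: (SK I).
- by move=> I J IJ JI; apply/seteqP; split.
- by move=> I J ->.
exists J; split=> //; first exact/sP.
by move=> K /sP; exact: Jmin.
Qed.

(** R*(L), as a closed ideal. *)
Definition star_ideal L : closedIdeal L := projT1 (cid (rad_star_spec L)).

Lemma star_idealE L : star_ideal L = rad_star P L :> set L.
Proof. by rewrite /star_ideal; case: cid => J []. Qed.

Lemma star_ideal_quot L u : ideal_set (P (quotlie (star_ideal L))) u -> u = 0.
Proof. by move: u; rewrite /star_ideal; case: cid => J []. Qed.

Lemma star_ideal_min L (K : closedIdeal L) :
  (forall u, ideal_set (P (quotlie K)) u -> u = 0) -> star_ideal L `<=` K.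
Proof. by move: K; rewrite /star_ideal; case: cid => J []. Qed.

Lemma star_ideal_ker L M (f : L -> M) : dense_hom f ->
  (forall y, ideal_set (P M) y -> y = 0) ->
  forall x, ideal_set (star_ideal L) x -> f x = 0.
Proof.
move=> fd PM; have [fh _] := fd.
pose K := ClosedIdeal (preimage_ideal fh (ClosedIdeal (zero_ideal M))).
have [||h hd hE] := dense_hom_factor fd (quotmap_hom K).
- by exists 2 => // u; exact: quotmap_lift.
- by move=> x /quotmap_eq0.
apply: (@star_ideal_min L K) => u; rewrite -(quotmap_repr u) => Pu.
apply/quotmap_eq0; rewrite /= -hE; apply: PM; exact: rad_dense_hom Pu.
Qed.

Lemma star_ideal_morphism L M (f : {linear L -> M}) :
  lie_morphism f -> f @` star_ideal L `<=` star_ideal M.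
Proof.
move=> /lie_morphism_dense_hom fd _ [x Qx <-]; apply/quotmap_eq0.
apply: (@star_ideal_ker _ _ (quotmap (star_ideal M) \o f)) Qx.
  by apply: comp_dense_hom => //; exact: quotmap_dense_hom.
exact: star_ideal_quot.
Qed.

(** The preradical R*. *)
Definition star_preradical : preradical R := Preradical star_ideal_morphism.

Lemma star_upper_stable : upper_stable star_preradical.
Proof.
move=> L; apply/seteqP; split=> [u|_ ->]; last exact: ideal0.
apply: (@star_ideal_ker _ _ id); last exact: star_ideal_quot.
by apply: surj_dense_hom (id_hom _) _ => y; exists y.
Qed.

(** For a closed ideal I of L and J = R*(L), P vanishes on the closure of the image
of I in L/J, which is an ideal of L/J. *)
Lemma star_balanced : balanced P -> balanced star_preradical.
Proof.
move=> bP L I _ [x Qx <-]; apply/quotmap_eq0.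
set q := quotmap _.
have qd : dense_hom q by exact: quotmap_dense_hom.
pose K := ClosedIdeal (closure_image_ideal I qd).
have fK (y : sublie I) : ideal_set K ((q \o @Defs.incl R L I) y).
  apply: subset_closure; exists (Defs.incl y) => //; exact: sublieP.
pose g := corestr (A := K) fK.
suff /(congr1 val) : g x = 0 by [].
apply: (@star_ideal_ker _ _ g) Qx.
  apply: corestr_dense_hom.
    by apply: comp_hom (incl_hom _) _; have [] := qd.
  move=> y; apply: closure_subset => _ [z Iz <-].
  by exists (exist _ z (mem_set Iz)).
move=> y Py; apply: val_inj; apply: (@star_ideal_quot L).
by apply: (bP _ K); exists y.
Qed.

Lemma rad_le_star : rad_le P star_preradical.
Proof.
move=> L x Px; apply/quotmap_eq0; apply: star_ideal_quot.
exact: rad_dense_hom (quotmap_dense_hom _) _ Px.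
Qed.

Lemma star_smallest (T : preradical R) :
  upper_stable T -> rad_le P T -> rad_le star_preradical T.
Proof.
move=> uT PT L; apply: star_ideal_min => u /PT; rewrite uT; exact.
Qed.

(** With J = R*(L) and K = R*(J), the ideal N = P(L/K) vanishes in L/J, so that
N lies in J/K and N = P(N) lies in P(J/K) = 0. Thus P(L/K) = 0 and K contains J. *)
Lemma star_lower_stable : lower_stable P -> balanced P -> lower_stable star_preradical.
Proof.
move=> lP bP L; set J := star_preradical L.
apply/seteqP; split; first exact: (@rad_in_sub _ star_preradical L J).
have iK := rad_in_ideal star_preradical (idealP J : closed_lie_ideal (J : closedSubalgebra L)).
pose K := ClosedIdeal iK.
apply: (@star_ideal_min L K) => u; rewrite -lP => -[v Pv vu].
have KJ : K `<=` J by exact: (@rad_in_sub _ star_preradical L J).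
have [h hd hE] := quotmap_factor KJ.
have hh : lie_hom h by have [] := hd.
(* J' is J/K as an ideal of L/K. *)
pose J' := ClosedIdeal (preimage_ideal hh (ClosedIdeal (zero_ideal (quotlie J)))).
have NJ' : P (quotlie K) `<=` J'.
  by move=> w Pw; apply: star_ideal_quot; exact: rad_dense_hom Pw.
have : rad_in P (J' : closedSubalgebra _) u.
  apply: (@rad_in_mono _ _ _ (P (quotlie K)) J' bP _ NJ'); first exact: idealP.
  by exists v.
move=> [w Pw <-].
have JJ' x : subalgebra_set J x <-> subalgebra_set J' (quotmap K x).
  by rewrite /= hE; split=> /quotmap_eq0.
have [g [gh gE glift]] := quotmap_restr JJ'.
have gK y : g y = 0 <-> ideal_set (star_ideal (sublie J)) y.
  split=> [/(congr1 (@Defs.incl _ _ _))|Qy].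
    rewrite gE => /quotmap_eq0; exact: (@rad_in_incl _ star_preradical).
  by apply: val_inj; rewrite [LHS]gE; apply/quotmap_eq0; exists y.
have [|k kd kE] := dense_hom_factor (quotmap_dense_hom (star_ideal (sublie J))) gh glift.
  by move=> y /gK; exact: (quotmap_eq0 _ _).2.
have [c _ /(_ w)[y yw _]] := glift.
suff : g y = 0 by rewrite yw => ->.
apply/gK/quotmap_eq0; rewrite -kE yw; apply: star_ideal_quot.
exact: rad_dense_hom Pw.
Qed.

End Star.

(** * The largest ideal fixed by a balanced preradical *)

Section Circ.
Variables (R : realType) (P : preradical R).
Hypothesis bP : balanced P.
Implicit Types L M N : banachLieType R.

Lemma rad_circ_spec L : exists J : closedIdeal L,
  [/\ rad_circ P L = J, J `<=` rad_in P J &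
      forall K : closedIdeal L, K `<=` rad_in P K -> K `<=` J].
Proof.
pose s (A : closedSubalgebra L) := ClosedSubalgebra (rad_subalgebra P A).
have [||||||||||A [iA sA AE Amax]] := @stable_value_transfinite (closedSubalgebra L) L
  (ClosedSubalgebra (full_subalgebra L)) s
  (fun S => ClosedSubalgebra (bigcap_subalgebra S))
  (fun A B => B `<=` A) (fun A => closed_lie_ideal A) (@subalgebra_set R L).
- by move=> A; exact: subset_refl.
- by move=> A B C AB BC; exact: subset_trans BC AB.
- by split; [by have [] := full_subalgebra L|].
- by move=> A; exact: rad_in_ideal.
- by [].
- by move=> A _; exact: rad_in_sub.
- by move=> A B iA iB BA; exact: rad_in_mono.
- move=> S S0 Sid _; split.
  + split; first by have [] := bigcap_subalgebra S.
    by move=> x y Sy A SA; have [_ h] := Sid _ SA; apply: h; exact: Sy.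
  + by move=> A SA x; apply.
  + by move=> A SA x Ax B SB; exact: SA.
- by move=> A B AB BA; apply/seteqP; split.
- by move=> A B ->.
exists (ClosedIdeal iA); split=> //.
  by move=> x /sA; exact: rad_in_mono.
by move=> K KP; apply: (Amax K) => //; exact: idealP.
Qed.

(** R°(L), as a closed ideal. *)
Definition circ_ideal L : closedIdeal L := projT1 (cid (rad_circ_spec L)).

Lemma circ_idealE L : circ_ideal L = rad_circ P L :> set L.
Proof. by rewrite /circ_ideal; case: cid => J []. Qed.

Lemma circ_ideal_fix L : circ_ideal L `<=` rad_in P (circ_ideal L).
Proof. by rewrite /circ_ideal; case: cid => J []. Qed.

Lemma circ_ideal_max L (K : closedIdeal L) : K `<=` rad_in P K -> K `<=` circ_ideal L.
Proof. by move: K; rewrite /circ_ideal; case: cid => J []. Qed.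

Lemma circ_ideal_morphism L M (f : {linear L -> M}) :
  lie_morphism f -> f @` circ_ideal L `<=` circ_ideal M.
Proof.
move=> /lie_morphism_dense_hom fd; have [fh _] := fd.
pose K := ClosedIdeal (closure_image_ideal (circ_ideal L) fd).
suff KM : K `<=` circ_ideal M.
  by apply: subset_trans KM; exact: subset_closure.
apply: circ_ideal_max => y clKy; apply: rad_in_closed.
apply: closure_subset clKy => _ [x /circ_ideal_fix[v Pv <-] <-].
apply: (@rad_hom_into _ _ _ _ K (f \o @Defs.incl _ _ _)) Pv.
- exact: comp_hom (incl_hom _) fh.
- move=> w; apply: subset_closure; exists (Defs.incl w) => //; exact: sublieP.
- move=> z; apply: closure_subset => _ [w Jw <-].
  by exists (exist _ w (mem_set Jw)).
Qed.

(** The preradical R°. *)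
Definition circ_preradical : preradical R := Preradical circ_ideal_morphism.

Lemma circ_lower_stable : lower_stable circ_preradical.
Proof.
move=> L; set J := circ_preradical L.
apply/seteqP; split; first exact: (@rad_in_sub _ circ_preradical L J).
have iF : closed_lie_ideal [set: sublie J].
  by split; [by have [] := full_subalgebra (sublie J)|].
pose F := ClosedIdeal iF.
move=> x Jx; exists (exist _ x (mem_set Jx)) => //.
apply: (@circ_ideal_max (sublie J) F) => // v _.
apply: (@rad_hom_into _ _ _ _ F id) => //; first exact: id_hom.
  by move=> y _; apply: subset_closure; exists y.
by apply: rad_in_incl; apply: circ_ideal_fix; exact: sublieP.
Qed.

(** For a closed ideal I of L, R°(I) is an ideal of L on which P is everything. *)
Lemma circ_balanced : balanced circ_preradical.
Proof.
move=> L I.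
have iK := rad_in_ideal circ_preradical (idealP I : closed_lie_ideal (I : closedSubalgebra L)).
apply: (@circ_ideal_max L (ClosedIdeal iK)).
move=> _ [_ /circ_ideal_fix[w Pw <-] <-].
apply: (@rad_hom_into _ _ _ _ (ClosedIdeal iK) (@Defs.incl _ _ _ \o @Defs.incl _ _ _)) Pw.
- exact: comp_hom (incl_hom _) (incl_hom _).
- by move=> v; exists (Defs.incl v) => //; exact: sublieP.
- move=> _ [v Qv <-]; apply: subset_closure.
  by exists (exist _ v (mem_set Qv)).
Qed.

(** With J = R°(L) and K = R°(L/J), the preimage N of K satisfies P(N) = N, since
N/P(N), on which P vanishes, is a quotient of K, on which P is everything. *)
Lemma circ_upper_stable : upper_stable P -> upper_stable circ_preradical.
Proof.
move=> uP L; set J := circ_preradical L; set K := circ_preradical _.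
apply/seteqP; split=> [u|_ ->]; last exact: ideal0.
pose N := ClosedIdeal (preimage_ideal (quotmap_hom J) K).
suff NJ : N `<=` J.
  by rewrite -(quotmap_repr u) => Ku; apply/quotmap_eq0; exact: NJ.
apply: circ_ideal_max => x Nx.
have JN : J `<=` N by move=> y /quotmap_eq0 Jy; rewrite /= Jy; exact: ideal0.
have JPN : J `<=` rad_in P N.
  by move=> y /circ_ideal_fix; apply: rad_in_mono => //; exact: idealP.
have NK y : subalgebra_set N y <-> subalgebra_set K (quotmap J y) by [].
have [g [gh gE glift]] := quotmap_restr NK.
have [|k kd kE] := dense_hom_factor (quotmap_dense_hom (P (sublie N))) gh glift.
  move=> y /(congr1 (@Defs.incl _ _ _)); rewrite gE => /quotmap_eq0 Jy.
  by apply/quotmap_eq0/rad_in_incl/JPN.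
pose y : sublie N := exist _ x (mem_set Nx).
exists y => //; apply/quotmap_eq0.
have : ideal_set (P (quotlie (P (sublie N)))) (k (g y)).
  apply: (rad_dense_hom kd); apply: rad_in_incl; apply: circ_ideal_fix; exact: sublieP.
by rewrite uP kE.
Qed.

Lemma circ_rad_le : rad_le circ_preradical P.
Proof. by move=> L x /circ_ideal_fix; exact: bP. Qed.

Lemma circ_largest (T : preradical R) :
  lower_stable T -> rad_le T P -> rad_le T circ_preradical.
Proof.
move=> lT TP L; apply: circ_ideal_max => x; rewrite -{1}lT => -[v Tv <-].
by exists v => //; exact: TP.
Qed.

End Circ.

Theorem theorem4p6 (R : realType) (P : preradical R) :
  (under_radical P ->
    exists Q : preradical R,
      (forall L : banachLieType R, Q L = rad_star P L :> set L) /\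
      [/\ radical Q, rad_le P Q &
          forall T : preradical R, radical T -> rad_le P T -> rad_le Q T]) /\
  (over_radical P ->
    exists Q : preradical R,
      (forall L : banachLieType R, Q L = rad_circ P L :> set L) /\
      [/\ radical Q, rad_le Q P &
          forall T : preradical R, radical T -> rad_le T P -> rad_le T Q]).
Proof.
split=> [[lP bP]|[uP bP]].
  exists (star_preradical P); split; first exact: star_idealE.
  split.
  - by split; [exact: star_lower_stable|exact: star_upper_stable|exact: star_balanced].
  - exact: rad_le_star.
  - by move=> T [_ uT _]; exact: star_smallest.
exists (circ_preradical bP); split; first exact: circ_idealE.
split.
- by split; [exact: circ_lower_stable|exact: circ_upper_stable|exact: circ_balanced].
- exact: circ_rad_le.
- by move=> T [lT _ _]; exact: circ_largest.
Qed.
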